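(* If $u:\Gamma\to\mathbb{R}$ is the viscosity solution of $$\min_{\mathbf{a}\in A_\mathbf{x}}\Big\{r(\mathbf{x},\mathbf{a})+\nabla_\Gamma u(\mathbf{x})\cdot f(\mathbf{x},\mathbf{a})\mathbf{a}\Big\}=0,\quad \mathbf{x}\in\Gamma\setminus\mathcal{T},\qquad u(\mathbf{x})=g(\mathbf{x}),\quad \mathbf{x}\in\mathcal{T},$$ then the constant normal extension $\overline u:T_\epsilon\to\mathbb{R}$, $\overline u(\mathbf{z})=u(P_\Gamma\mathbf{z})$, is the viscosity solution of $$\min_{\mathbf{a}\in A_\mathbf{z}}\Big\{\overline r(\mathbf{z},\mathbf{a})+\nabla v(\mathbf{z})\cdot \overline f(\mathbf{z},\mathbf{a})B(\mathbf{z},\mu)\mathbf{a}\Big\}=0,\quad \mathbf{z}\in T_\epsilon\setminus\overline{\mathcal{T}},\qquad v(\mathbf{z})=\overline g(\mathbf{z}),\quad \mathbf{z}\in\overline{\mathcal{T}}.$$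
   Context: Geometry. Let $n\in\{2,3\}$, let $\Omega\subset\mathbb{R}^n$ be a bounded connected open set with smooth closed boundary $\Gamma=\partial\Omega$. For $\epsilon>0$ let $T_\epsilon=\{\mathbf{z}\in\mathbb{R}^n:\min_{\mathbf{x}\in\Gamma}\|\mathbf{x}-\mathbf{z}\|<\epsilon\}$. Throughout, $\epsilon$ is small enough (smaller than the reach of $\Gamma$) that the closest point map $P_\Gamma:T_\epsilon\to\Gamma$, $P_\Gamma(\mathbf{z})=\arg\min_{\mathbf{y}\in\Gamma}\|\mathbf{z}-\mathbf{y}\|$, is well defined and differentiable. Let $d_\Gamma$ be the signed distance to $\Gamma$ on $T_\epsilon$ (negative in $\Omega$, positive outside $\overline\Omega$), and for $|\eta|<\epsilon$ let $\Gamma_\eta=\{\mathbf{z}\in T_\epsilon: d_\Gamma(\mathbf{z})=\eta\}$ be the parallel surface. $\nabla_\Gamma$ is the surface (tangential) gradient. The tensor $B$. For $\mathbf{z}\in T_\epsilon$ with $\eta=d_\Gamma(\mathbf{z})$, let $\mathbf{t}_1,\mathbf{t}_2$ be orthonormal tangent vectors in the principal curvature directions of $\Gamma_\eta$ at $\mathbf{z}$, $\mathbf{n}$ the unit normal to $\Gamma_\eta$ at $\mathbf{z}$, and $\sigma_1,\sigma_2$ the singular values of the Jacobian $P_\Gamma'(\mathbf{z})$ associated with $\mathbf{t}_1,\mathbf{t}_2$, i.e. $P_\Gamma'(\mathbf{z})=\sigma_1\mathbf{t}_1\otimes\mathbf{t}_1+\sigma_2\mathbf{t}_2\otimes\mathbf{t}_2$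 (with $\sigma_i=1-d_\Gamma(\mathbf{z})\kappa_i(\mathbf{z})>0$, $\kappa_i$ the principal curvatures of $\Gamma_\eta$ at $\mathbf{z}$). For a fixed real number $\mu$, $$B(\mathbf{z},\mu)=\sigma_1^{-1}\mathbf{t}_1\otimes\mathbf{t}_1+\sigma_2^{-1}\mathbf{t}_2\otimes\mathbf{t}_2+\mu\,\mathbf{n}\otimes\mathbf{n}$$ (for $n=2$ there is only $\mathbf{t}_1,\sigma_1$, and the $\mathbf{t}_2$ term is absent). Data. For $\mathbf{x}\in\Gamma$ let $A_\mathbf{x}=S^{n-1}\cap T_\mathbf{x}\Gamma$; for $\mathbf{z}\in T_\epsilon$ let $A_\mathbf{z}:=A_{P_\Gamma\mathbf{z}}$; let $A=\bigcup_{\mathbf{x}\in\Gamma}A_\mathbf{x}$. $\mathcal{T}\subset\Gamma$ is closed; $f,r:\Gamma\times A\to\mathbb{R}$ and $g:\mathcal{T}\to\mathbb{R}$ satisfy: $f$ and $r$ are Lipschitz continuous in their first arguments; $g$ is lower semicontinuous with $\min_\mathcal{T}g<\infty$; there are constants with $0<R_1\le r(\mathbf{x},\mathbf{a})\le R_2$ and $0<F_1\le f(\mathbf{x},\mathbf{a})\le F_2$ for all $\mathbf{x}\in\Gamma$, $\mathbf{a}\in A$. The extensions are $\overline f(\mathbf{z},\mathbf{a})=f(P_\Gamma\mathbf{z},\mathbf{a})$, $\overline r(\mathbf{z},\mathbf{a})=r(P_\Gamma\mathbf{z},\mathbf{a})$ for $\mathbf{z}\in T_\epsilon$, $\overline{\mathcal{T}}=\{\mathbf{z}\in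 T_\epsilon:P_\Gamma\mathbf{z}\in\mathcal{T}\}$, and $\overline g(\mathbf{z})=g(P_\Gamma\mathbf{z})$ for $\mathbf{z}\in\overline{\mathcal{T}}$. Viscosity solutions. For an equation $H(\mathbf{x},\nabla w(\mathbf{x}))=0$ on $M\setminus K$ with $w=h$ on $K$ (here $M=\Gamma$ with the surface gradient, or $M=T_\epsilon$ with the Euclidean gradient), where $H$ is the minimum expression displayed, a continuous function $w:M\to\mathbb{R}$ with $w=h$ on $K$ is a viscosity solution if it is a subsolution and a supersolution: for every $\phi\in C^1(M)$ and $\mathbf{x}_0\in M\setminus K$, $H(\mathbf{x}_0,\nabla\phi(\mathbf{x}_0))\ge 0$ whenever $w-\phi$ has a local maximum at $\mathbf{x}_0$ (subsolution), and $H(\mathbf{x}_0,\nabla\phi(\mathbf{x}_0))\le0$ whenever $w-\phi$ has a local minimum at $\mathbf{x}_0$ (supersolution). (This is the usual notion for the equation $-H=0$, the convention under which the value function of the associated minimal-cost control problem is the viscosity solution.) The article ''the'' follows the paper, which takes uniqueness of viscosity solutions under these assumptions as known. *)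

(* Defs.v *)
From mathcomp Require Import all_boot all_order all_algebra.
From mathcomp Require Import all_classical all_reals all_analysis.

Set Implicit Arguments.
Unset Strict Implicit.
Unset Printing Implicit Defensive.

Import Order.TTheory GRing.Theory Num.Theory.
Import numFieldNormedType.Exports.

Local Open Scope classical_set_scope.
Local Open Scope ring_scope.

Section Euclidean.
Context {R : realType} {n : nat}.
Local Notation V := 'rV[R]_n.

(* The library norm `|v| on row vectors is the max norm; it induces the same
   topology, differentiability, boundedness and Lipschitz functions as the
   Euclidean norm, but distances to a surface need the Euclidean one. *)
Definition dot (u v : V) : R := \sum_i u 0 i * v 0 i.
Definition enorm (v : V) : R := Num.sqrt (dot v v).

(* Row vectors are acted on from the right: a *m outer u v = dot a v *: u. *)
Definition outer (u v : V) : 'M[R]_n := v^T *m u.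

Definition grad (phi : V -> R) (x : V) : V :=
  \row_i 'D_(delta_mx 0 i) phi x.

(* For open U only. *)
Fixpoint Ck_on (k : nat) (U : set V) (phi : V -> R) : Prop :=
  if k is k'.+1 then
    (forall x, U x -> differentiable phi x) /\
    (forall i, Ck_on k' U (fun x => 'D_(delta_mx 0 i) phi x))
  else forall x, U x -> {for x, continuous phi}.

Definition smooth_on (U : set V) (phi : V -> R) : Prop :=
  forall k, Ck_on k U phi.

Definition boundary (Om : set V) : set V := closure Om `\` interior Om.

Definition smooth_boundary (Om : set V) : Prop :=
  forall x, boundary Om x ->
  exists (U : set V) (phi : V -> R),
    [/\ open U, U x, smooth_on U phi &
        [/\ forall y, U y -> grad phi y != 0,
            forall y, U y -> (Om y <-> phi y < 0) &
            forall y, U y -> (boundary Om y <-> phi y = 0)]].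

(* For S nonempty and compact the infimum is a minimum. *)
Definition dist (S : set V) (z : V) : R := inf [set enorm (x - z) | x in S].

Definition tube (S : set V) (eps : R) : set V := [set z | dist S z < eps].

Definition nearest (S : set V) (z : V) : set V :=
  [set y | S y /\ forall x, S x -> enorm (y - z) <= enorm (x - z)].

Definition reach (S : set V) : \bar R :=
  ereal_sup [set rho%:E | rho in
    [set rho : R | forall z, dist S z < rho -> exists! y, nearest S z y]].

(* Meaningful where the nearest point exists and is unique. *)
Definition closest_point (S : set V) (z : V) : V := get (nearest S z).

Definition signed_dist (Om : set V) (z : V) : R :=
  if `[< Om z >] then - dist (boundary Om) z else dist (boundary Om) z.

Definition parallel_surface (Om : set V) (eps eta : R) : set V :=
  [set z | tube (boundary Om) eps z /\ signed_dist Om z = eta].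

Definition curve_through (S : set V) (x : V) (gam : R -> V) (v : V) : Prop :=
  [/\ gam 0 = x, \forall s \near (0 : R), S (gam s) &
      is_derive (0 : R) (1 : R) gam v].

Definition tangent_space (S : set V) (x : V) : set V :=
  [set v | exists gam, curve_through S x gam v].

Definition unit_normal (S : set V) (x nu : V) : Prop :=
  enorm nu = 1 /\ forall v, tangent_space S x v -> dot nu v = 0.

Definition unit_tangents (S : set V) (x : V) : set V :=
  [set a | enorm a = 1 /\ tangent_space S x a].

Definition C1_surface (S : set V) (phi : V -> R) : Prop :=
  forall x, S x -> exists (U : set V) (psi : V -> R),
    [/\ open U, U x, Ck_on 1 U psi & forall y, U y -> S y -> psi y = phi y].

(* Only the values of phi on S matter. *)
Definition is_surface_grad (S : set V) (phi : V -> R) (x p : V) : Prop :=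
  tangent_space S x p /\
  forall gam v, curve_through S x gam v ->
    is_derive (0 : R) (1 : R) (phi \o gam) (dot p v).

Definition surface_grad (S : set V) (phi : V -> R) (x : V) : V :=
  get (is_surface_grad S phi x).

(* The gradient of the signed distance is the outward unit normal field of the
   parallel surfaces, so this is the Weingarten equation D_t n = kappa t on the
   surface through z. With this sign kappa > 0 on spheres bounding a ball Om,
   which is the sign for which sigma = 1 - d * kappa. *)
Definition principal_direction (Om : set V) (eps : R) (z t : V) (kappa : R) :
    Prop :=
  tangent_space (parallel_surface Om eps (signed_dist Om z)) z t /\
  is_derive z t (grad (signed_dist Om)) (kappa *: t).

Definition principal_frame (Om : set V) (eps : R) (z : V)
    (t : 'I_n.-1 -> V) (nu : V) (kappa sigma : 'I_n.-1 -> R) : Prop :=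
  [/\ forall i j, dot (t i) (t j) = (i == j)%:R,
      forall i, principal_direction Om eps z (t i) (kappa i),
      unit_normal (parallel_surface Om eps (signed_dist Om z)) z nu,
      'J (closest_point (boundary Om)) z =
        \sum_i sigma i *: outer (t i) (t i) &
      forall i, sigma i = 1 - signed_dist Om z * kappa i /\ 0 < sigma i].

Definition tensorB (t : 'I_n.-1 -> V) (nu : V) (sigma : 'I_n.-1 -> R)
    (mu : R) : 'M[R]_n :=
  \sum_i (sigma i)^-1 *: outer (t i) (t i) + mu *: outer nu nu.

(* The minimum over controls is taken as an infimum: no continuity in the
   control is available to guarantee that it is attained. *)
Definition hamiltonian (A : V -> set V) (r : V -> V -> R) (F : V -> V -> V)
    (x p : V) : R :=
  inf [set r x a + dot p (F x a) | a in A x].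

Definition local_max_on (M : set V) (w : V -> R) (x0 : V) : Prop :=
  \forall y \near within M (nbhs x0), w y <= w x0.

Definition local_min_on (M : set V) (w : V -> R) (x0 : V) : Prop :=
  \forall y \near within M (nbhs x0), w x0 <= w y.

(* Functions on M or K are represented by functions on the whole space whose
   other values are irrelevant; C1M is the class C^1(M) and gradM its gradient. *)
Definition viscosity_solution (M K : set V) (C1M : (V -> R) -> Prop)
    (gradM : (V -> R) -> V -> V) (H : V -> V -> R) (h w : V -> R) : Prop :=
  [/\ {within M, continuous w},
      forall x, K x -> w x = h x,
      forall phi x0, C1M phi -> (M `\` K) x0 ->
        local_max_on M (w \- phi) x0 -> 0 <= H x0 (gradM phi x0) &
      forall phi x0, C1M phi -> (M `\` K) x0 ->
        local_min_on M (w \- phi) x0 -> H x0 (gradM phi x0) <= 0].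

End Euclidean.

(* Main.v *)
Require Import Defs.
From mathcomp Require Import all_boot all_order all_algebra.
From mathcomp Require Import all_classical all_reals all_analysis.
From mathcomp Require Import ring lra.

(* Let N be the outward normal of Gam, x0 = P z0 and eta the normal coordinate of
   z0, so that z0 = x0 + eta N(x0). The map Q(y) = y + eta N(y) is C^1 on Gam, and
   P (Q y) = y for y in Gam near x0: P (Q y) =: y' satisfies
   y + eta N(y) = y' + k N(y'), and (y, k) |-> y + k N(y) is injective near
   (x0, eta) because id + eta DN(x0) maps t_i to t_i / sigma_i. Hence, if phi
   touches u o P from one side at z0, then psi = phi o Q touches u from the same
   side at x0. For a tangent at x0 we have DQ(x0) a = B a, so that
   grad_Gam psi(x0) . a = grad phi(z0) . B a and the two Hamiltonians agree.
   Since P is only known to be differentiable, the injectivity is obtained from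
   strict differentiability of N and of the defining functions. *)

Import Order.TTheory GRing.Theory Num.Theory.
Import numFieldNormedType.Exports.

Local Open Scope classical_set_scope.
Local Open Scope ring_scope.

(** The origin of [N] and of DN: near each boundary point [N] is the normalized gradient of a
    defining function, hence C^1 by smoothness; mere differentiability of P gives no continuous
    derivative to build a C^1 field from. The values of DN on the frame are read off from P', by
    differentiating z = P z + d(z) N(P z).

    The number eta is kept fixed in Q, so that Q y keeps the normal coordinate eta and no normal
    derivative of phi enters; this matches B a, which is tangential for tangential a.

    Two obstacles shape the injectivity argument. The second coordinate k is not known to be close
    to eta; it is eliminated because the difference of the two offset points is a multiple of N(y'),
    which is almost orthogonal to every t_i. And the extension of [N] off the boundary depends on
    the defining function, so its derivative along the normal is uncontrolled; it is only ever
    multiplied by the normal component of y - y', which is of lower order since phi vanishes at both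
    points. *)

Section Dot.
Context {R : realType} {n : nat}.
Implicit Types (u v w : 'rV[R]_n).

(** * Euclidean inner product and orthonormal frames *)

Lemma dotC u v : dot u v = dot v u.
Proof. by apply: eq_bigr => i _; rewrite mulrC. Qed.

Lemma dotDl u v w : dot (u + v) w = dot u w + dot v w.
Proof. by rewrite -big_split; apply: eq_bigr => i _; rewrite mxE mulrDl. Qed.

Lemma dotZl a u v : dot (a *: u) v = a * dot u v.
Proof. by rewrite mulr_sumr; apply: eq_bigr => i _; rewrite mxE mulrA. Qed.

Lemma dotDr u v w : dot u (v + w) = dot u v + dot u w.
Proof. by rewrite dotC dotDl !(dotC u). Qed.

Lemma dotZr a u v : dot u (a *: v) = a * dot u v.
Proof. by rewrite dotC dotZl dotC. Qed.

Lemma dotNl u v : dot (- u) v = - dot u v.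
Proof. by rewrite -scaleN1r dotZl mulN1r. Qed.

Lemma dotBl u v w : dot (u - v) w = dot u w - dot v w.
Proof. by rewrite dotDl dotNl. Qed.

Lemma dot0r u : dot u 0 = 0.
Proof. by rewrite -(scale0r 0) dotZr mul0r. Qed.

Lemma dot0l u : dot 0 u = 0.
Proof. by rewrite dotC dot0r. Qed.

Lemma dot_sumr (I : Type) (s : seq I) (v : I -> 'rV[R]_n) u :
  dot u (\sum_(i <- s) v i) = \sum_(i <- s) dot u (v i).
Proof. by apply: big_morph; [exact: dotDr | exact: dot0r]. Qed.

Lemma dot_suml (I : Type) (s : seq I) (v : I -> 'rV[R]_n) u :
  dot (\sum_(i <- s) v i) u = \sum_(i <- s) dot (v i) u.
Proof. by apply: (big_morph (dot^~ u)); [exact: (fun v w => dotDl v w u) | exact: dot0l]. Qed.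

Lemma dot_mul u v : u *m v^T = (dot u v)%:M.
Proof.
apply/matrixP => i j; rewrite !ord1 !mxE eqxx mulr1n.
by apply: eq_bigr => k _; rewrite !mxE.
Qed.

Lemma mulmx_outer u v w : u *m outer v w = dot u w *: v.
Proof. by rewrite /outer mulmxA dot_mul mul_scalar_mx. Qed.

Lemma dot_ge0 u : 0 <= dot u u.
Proof. by apply: sumr_ge0 => i _; rewrite -expr2 sqr_ge0. Qed.

Lemma dot_eq0 u : (dot u u == 0) = (u == 0).
Proof.
apply/idP/eqP => [|->]; last by rewrite dot0r.
rewrite psumr_eq0; last by move=> i _; rewrite -expr2 sqr_ge0.
move=> /allP u0; apply/rowP => i; have := u0 i (mem_index_enum i).
by rewrite mulf_eq0 orbb mxE => /eqP.
Qed.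

Lemma dot_enorm u : dot u u = enorm u ^+ 2.
Proof. by rewrite sqr_sqrtr ?dot_ge0. Qed.

Lemma enorm_ge0 u : 0 <= enorm u.
Proof. exact: sqrtr_ge0. Qed.

Lemma enorm_eq0 u : (enorm u == 0) = (u == 0).
Proof. by rewrite -dot_eq0 dot_enorm sqrf_eq0. Qed.

Lemma enormZ a u : enorm (a *: u) = `|a| * enorm u.
Proof.
by rewrite /enorm dotZl dotZr mulrA -expr2 sqrtrM ?sqr_ge0// sqrtr_sqr.
Qed.

Lemma enorm1 u : enorm u = 1 <-> dot u u = 1.
Proof.
rewrite dot_enorm; split=> [->|/eqP]; first by rewrite expr1n.
by rewrite sqrp_eq1 ?enorm_ge0 // => /eqP.
Qed.

Lemma dot_delta u i : dot u (delta_mx 0 i) = u 0 i.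
Proof.
rewrite /dot (bigD1 i) //= big1 ?addr0 => [|j ji]; rewrite mxE eqxx.
  by rewrite eqxx mulr1.
by rewrite (negbTE ji) mulr0.
Qed.

Lemma coord_norm u i : `|u 0 i| <= `|u|.
Proof.
by rewrite [leRHS]mx_normrE (le_bigmax _ (fun k => `|u k.1 k.2|) (0, i)).
Qed.

Lemma norm_le_coord u c : 0 <= c -> (forall i, `|u 0 i| <= c) -> `|u| <= c.
Proof.
move=> c0 uc; rewrite [leLHS]mx_normrE (bigmax_le _ c0)// => -[i j] _ /=.
by rewrite ord1.
Qed.

Lemma dot_norm_le u v c : (forall i, `|v 0 i| <= c) -> `|dot u v| <= n%:R * c * `|u|.
Proof.
move=> vc; apply: (le_trans (ler_norm_sum _ _ _)).
apply: (@le_trans _ _ (\sum_(i < n) c * `|u|)); last first.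
  by rewrite sumr_const card_ord mulr_natl mulrnAl.
apply: ler_sum => i _; rewrite normrM mulrC.
by apply: ler_pM => //; exact: coord_norm.
Qed.

End Dot.

(** The matrix [M] with rows [nu], [t i] is square, so [M *m M^T = 1] also gives [M^T *m M = 1];
    applied to [w] this is the expansion. *)
Lemma orthonormal_expansion {R : realType} {m : nat} {t : 'I_m -> 'rV[R]_m.+1}
    {nu : 'rV[R]_m.+1} :
  (forall i j, dot (t i) (t j) = (i == j)%:R) -> dot nu nu = 1 ->
  (forall i, dot nu (t i) = 0) ->
  forall w, w = dot w nu *: nu + \sum_i dot w (t i) *: t i.
Proof.
move=> tt nn nt w.
pose e k := if unlift ord0 k is Some i then t i else nu.
have e0 : e ord0 = nu by rewrite /e unlift_none.
have eS i : e (lift ord0 i) = t i by rewrite /e liftK.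
pose M := \matrix_k e k.
have MM : M *m M^T = 1%:M.
  apply/matrixP => j k; transitivity (dot (e j) (e k)).
    by rewrite !mxE; apply: eq_bigr => i _; rewrite !mxE.
  rewrite mxE.
  case: (unliftP ord0 j) => [j'|] ->; case: (unliftP ord0 k) => [k'|] ->;
    rewrite ?e0 ?eS ?eqxx ?tt ?nn ?nt //; first by rewrite dotC nt.
rewrite -[LHS]mulmx1 -(mulmx1C MM) mulmxA mulmx_sum_row big_ord_recl !rowK e0.
congr (_ *: _ + _).
  by rewrite mxE; apply: eq_bigr => i _; rewrite !mxE e0.
apply: eq_bigr => k _; rewrite rowK eS; congr (_ *: _).
by rewrite mxE; apply: eq_bigr => i _; rewrite !mxE eS.
Qed.

(** * Derivatives along curves and of vector-valued maps *)

Section Calculus.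
Context {R : realType}.

Lemma is_derive_curve_comp {V W : normedModType R} (F : V -> W) (c : R -> V) s v :
  differentiable F (c s) -> is_derive s (1 : R) c v ->
  is_derive s (1 : R) (F \o c) ('D_v F (c s)).
Proof.
move=> dF dc; have dc' : differentiable c s by apply/derivable1_diffP.
apply: DeriveDef; first by apply/derivable1_diffP/differentiable_comp.
rewrite deriveE; last exact: differentiable_comp.
have dcv : 'd c s (1 : R) = v by rewrite -deriveE // derive_val.
by rewrite diff_comp // /= dcv deriveE.
Qed.

Lemma is_derive_line {V : normedModType R} (x v : V) (s : R) :
  is_derive s (1 : R) (fun s : R => x + s *: v) v.
Proof.
have -> : (fun s : R => x + s *: v) = cst x + (fun s : R => s *: v) by [].
apply: is_derive_eq (_ : 0 + v = v); last by rewrite add0r.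
apply: is_deriveD; apply: DeriveDef.
  by apply/derivable1_diffP; exact: differentiableZl.
by rewrite deriveE ?diffZl ?diff_val ?scale1r//; exact: differentiableZl.
Qed.

Context {n : nat}.
Implicit Types (U : set 'rV[R]_n) (phi : 'rV[R]_n -> R).

Lemma derive_grad phi x v : differentiable phi x -> 'D_v phi x = dot (grad phi x) v.
Proof.
move=> dphi; rewrite deriveE // {1}(row_sum_delta v) linear_sum.
apply: eq_bigr => i _; rewrite linearZ /= mxE deriveE //.
by rewrite mulrC.
Qed.

Lemma is_derive_coord (c : R -> 'rV[R]_n) (s : R) (v : 'rV[R]_n) i :
  is_derive s (1 : R) c v -> is_derive s (1 : R) (fun s => c s 0 i) (v 0 i).
Proof.
move=> dc; have /derivable_mxP /(_ 0 i) dci : derivable c s 1 by [].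
have <- : 'D_(1 : R) c s = v by exact: derive_val.
by apply: DeriveDef => //; rewrite derive_mx // mxE.
Qed.

Lemma is_derive_rV (c : R -> 'rV[R]_n) (s : R) (v : 'rV[R]_n) :
  (forall i, is_derive s (1 : R) (fun s => c s 0 i) (v 0 i)) ->
  is_derive s (1 : R) c v.
Proof.
move=> dc; have dcs : derivable c s 1.
  by apply/derivable_mxP => i j; rewrite ord1.
apply: DeriveDef => //; rewrite derive_mx //.
by apply/rowP => i; rewrite mxE derive_val.
Qed.

Lemma is_derive_dot (c d : R -> 'rV[R]_n) (s : R) (v w : 'rV[R]_n) :
  is_derive s (1 : R) c v -> is_derive s (1 : R) d w ->
  is_derive s (1 : R) (fun s => dot (c s) (d s)) (dot v (d s) + dot (c s) w).
Proof.
move=> dc dd; have -> : (fun s => dot (c s) (d s)) =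
    \sum_i ((fun s => c s 0 i) * (fun s => d s 0 i)).
  by apply/funext => r; rewrite fct_sumE.
rewrite -big_split /=; apply: is_derive_sum => i.
have dci := is_derive_coord _ _ _ i dc; have ddi := is_derive_coord _ _ _ i dd.
by apply: is_derive_eq; rewrite addrC mulrC; congr (_ + _); rewrite mulrC.
Qed.

Lemma is_derive_scale (a : R -> R) (c : R -> 'rV[R]_n) (s b : R) (v : 'rV[R]_n) :
  is_derive s (1 : R) a b -> is_derive s (1 : R) c v ->
  is_derive s (1 : R) (fun s => a s *: c s) (b *: c s + a s *: v).
Proof.
move=> da dc; apply: is_derive_rV => i; rewrite !mxE.
have -> : (fun s => (a s *: c s) 0 i) = a * (fun s => c s 0 i).
  by apply/funext => r; rewrite mxE.
have dci := is_derive_coord _ _ _ i dc.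
by apply: is_derive_eq; rewrite addrC; congr (_ + _); exact: mulrC.
Qed.

Lemma differentiable_rV {V : normedModType R} (F : V -> 'rV[R]_n) x :
  (forall i, differentiable (fun y => F y 0 i) x) -> differentiable F x.
Proof.
move=> dF; have -> : F = \sum_i (fun y => F y 0 i *: delta_mx 0 i).
  by apply/funext => y; rewrite fct_sumE {1}(row_sum_delta (F y)).
by apply: differentiable_sum => i; exact: differentiableZl.
Qed.

Lemma derive_coord {V : normedModType R} (F : V -> 'rV[R]_n) x v i :
  differentiable F x -> 'D_v F x 0 i = 'D_v (fun y => F y 0 i) x.
Proof. by move=> dF; rewrite derive_mx ?mxE //; exact: diff_derivable. Qed.

End Calculus.

(** * C^1 functions: closure properties and strict differentiability *)

Section C1.
Context {R : realType} {n : nat}.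
Implicit Types (U O : set 'rV[R]_n) (phi f g : 'rV[R]_n -> R).

(** Product and chain rules give the partial derivatives by formulas valid on an open set only;
    continuity passes through such a local equality. *)
Lemma continuous_near_eq {T T' : topologicalType} (F G : T -> T') x :
  (\forall y \near x, F y = G y) -> {for x, continuous G} -> {for x, continuous F}.
Proof.
move=> FG cG; rewrite /prop_for /continuous_at (nbhs_singleton FG).
apply: cvg_trans cG; apply: near_eq_cvg.
by near=> y; apply/esym; near: y.
Unshelve. all: by end_near. Qed.

Lemma C1_cst U (a : R) : Ck_on 1 U (fun=> a).
Proof.
split=> [x _|i x _]; first exact: differentiable_cst.
apply: (@continuous_near_eq _ _ _ (cst 0)); last exact: cst_continuous.
by near=> y; exact: derive_cst.
Unshelve. all: by end_near. Qed.

Lemma C1_coord U j : Ck_on 1 U (fun y => y 0 j).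
Proof.
have dc y : differentiable (fun y : 'rV[R]_n => y 0 j) y by exact: differentiable_coord.
split=> [x _ //|i x _].
apply: (@continuous_near_eq _ _ _ (cst ((delta_mx 0 i : 'rV[R]_n) 0 j))).
  near=> y; have := @derive_coord R n _ (fun y => y) y (delta_mx 0 i) j.
  by move=> <- //; rewrite derive_id.
exact: cst_continuous.
Unshelve. all: by end_near. Qed.

Lemma C1_add U f g : open U -> Ck_on 1 U f -> Ck_on 1 U g ->
  Ck_on 1 U (fun y => f y + g y).
Proof.
move=> oU [df cf] [dg cg]; split=> [x Ux|i x Ux].
  by apply: differentiableD; [exact: df | exact: dg].
apply: (@continuous_near_eq _ _ _
  (fun y => 'D_(delta_mx 0 i) f y + 'D_(delta_mx 0 i) g y)).
  near=> y; have Uy : U y by near: y; exact: open_nbhs_nbhs.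
  by rewrite -deriveD //; apply: diff_derivable; [exact: df | exact: dg].
exact: cvgD (cf i x Ux) (cg i x Ux).
Unshelve. all: by end_near. Qed.

Lemma C1_mul U f g : open U -> Ck_on 1 U f -> Ck_on 1 U g ->
  Ck_on 1 U (fun y => f y * g y).
Proof.
move=> oU [df cf] [dg cg]; split=> [x Ux|i x Ux].
  by apply: differentiableM; [exact: df | exact: dg].
apply: (@continuous_near_eq _ _ _
  (fun y => f y * 'D_(delta_mx 0 i) g y + g y * 'D_(delta_mx 0 i) f y)).
  near=> y; have Uy : U y by near: y; exact: open_nbhs_nbhs.
  by rewrite deriveM //; apply: diff_derivable; [exact: df | exact: dg].
have fc := differentiable_continuous (df x Ux).
have gc := differentiable_continuous (dg x Ux).
exact: cvgD (cvgM fc (cg i x Ux)) (cvgM gc (cf i x Ux)).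
Unshelve. all: by end_near. Qed.

Lemma C1_sum U k (f : 'I_k -> 'rV[R]_n -> R) : open U ->
  (forall j, Ck_on 1 U (f j)) -> Ck_on 1 U (fun y => \sum_j f j y).
Proof.
move=> oU Cf; have -> : (fun y => \sum_j f j y) = \sum_j f j.
  by apply/funext => y; rewrite fct_sumE.
by elim/big_ind : _ => // [|F G]; [exact: C1_cst | exact: C1_add].
Qed.

Lemma C1_comp_real U f (h dh : R -> R) : open U -> Ck_on 1 U f ->
  (forall x, U x -> is_derive (f x) (1 : R) h (dh (f x))) ->
  (forall x, U x -> {for f x, continuous dh}) ->
  Ck_on 1 U (h \o f).
Proof.
move=> oU [df cf] dhf cdh.
have dh' x : U x -> differentiable h (f x).
  by move=> Ux; have hx := dhf x Ux; apply/derivable1_diffP.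
split=> [x Ux|i x Ux].
  by apply: differentiable_comp; [exact: df | exact: dh'].
apply: (@continuous_near_eq _ _ _ (fun y => 'D_(delta_mx 0 i) f y * dh (f y))).
  near=> y; have Uy : U y by near: y; exact: open_nbhs_nbhs.
  have dfy := df y Uy; have dhy := dh' y Uy; have dhy' := dhf y Uy.
  have hE r : 'd h (f y) r = r * dh (f y).
    rewrite -[X in 'd h _ X]mulr1 [LHS]linearZ -(deriveE _ dhy).
    by congr (_ * _); exact: derive_val.
  rewrite (deriveE _ (differentiable_comp dfy dhy)) (diff_comp dfy dhy).
  by rewrite (deriveE _ dfy); exact: hE.
have fc := differentiable_continuous (df x Ux).
exact: cvgM (cf i x Ux) (continuous_comp fc (cdh x Ux)).
Unshelve. all: by end_near. Qed.

Lemma C1_comp U O (F : 'rV[R]_n -> 'rV[R]_n) phi : open U ->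
  (forall j, Ck_on 1 U (fun y => F y 0 j)) -> (forall x, U x -> O (F x)) ->
  Ck_on 1 O phi -> Ck_on 1 U (phi \o F).
Proof.
move=> oU CF FUO [dphi cphi].
have dF x : U x -> differentiable F x.
  by move=> Ux; apply: differentiable_rV => i; exact: (CF i).1.
have dp x : U x -> differentiable phi (F x) by move=> /FUO; exact: dphi.
split=> [x Ux|i x Ux].
  by apply: differentiable_comp; [exact: dF | exact: dp].
apply: (@continuous_near_eq _ _ _ (fun y => \sum_j
  'D_(delta_mx 0 j) phi (F y) * 'D_(delta_mx 0 i) (fun y => F y 0 j) y)).
  near=> y; have Uy : U y by near: y; exact: open_nbhs_nbhs.
  have dFy := dF y Uy; have dpy := dp y Uy.
  rewrite (deriveE _ (differentiable_comp dFy dpy)) (diff_comp dFy dpy).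
  transitivity ('D_('D_(delta_mx 0 i) F y) phi (F y)).
    by rewrite (deriveE _ dFy) (deriveE _ dpy).
  rewrite (derive_grad _ _ _ dpy); apply: eq_bigr => j _.
  by rewrite (derive_coord _ _ _ _ dFy) mxE.
rewrite /prop_for /continuous_at; apply: cvg_big => [||j _]; [exact: add_continuous | exact: nbhs_filter |].
have Fc := differentiable_continuous (dF x Ux).
exact: cvgM (continuous_comp Fc (cphi j _ (FUO _ Ux))) ((CF j).2 i x Ux).
Unshelve. all: by end_near. Qed.

(** Mean value theorem on the segment from [y'] to [y]: it stays in a ball where the gradient varies
    little. Both points may move, which plain differentiability at [x0] would not allow. *)
Lemma C1_strictly_differentiable U phi x0 : open U -> Ck_on 1 U phi -> U x0 ->
  forall c, 0 < c -> exists2 d, 0 < d & forall y y' : 'rV[R]_n, `|y - x0| < d ->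
    `|y' - x0| < d ->
    `|phi y - phi y' - dot (grad phi x0) (y - y')| <= c * `|y - y'|.
Proof.
move=> oU [dphi cphi] Ux0 c c0.
(* [dot_norm_le] loses a factor [n] against the max norm; [n.+1] instead of [n] keeps the
   denominator nonzero. *)
pose c' := c / n.+1%:R; have c'0 : 0 < c' by rewrite divr_gt0.
have : \forall z \near x0, U z /\ forall i,
    `|'D_(delta_mx 0 i) phi z - 'D_(delta_mx 0 i) phi x0| <= c'.
  near=> z; split; first by near: z; exact: open_nbhs_nbhs.
  near: z; apply: filter_forall => i.
  by have /cvgrPdistC_le := cphi i x0 Ux0; apply.
move=> /nbhs_normP[d d0 dH]; exists d => // y y' yd y'd.
have seg (s : R) : s \in `[0, 1] -> `|y' + s *: (y - y') - x0| < d.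
  rewrite in_itv /= => /andP[s0 s1].
  have -> : y' + s *: (y - y') - x0 = (1 - s) *: (y' - x0) + s *: (y - x0).
    by rewrite !scalerBr !scalerBl !scale1r; apply/rowP => i; rewrite !mxE; ring.
  apply: le_lt_trans (ler_normD _ _) _; rewrite !normrZ (ger0_norm s0) ger0_norm ?subr_ge0//.
  have [->|s_neq0] := eqVneq s 0; first by rewrite subr0 mul1r mul0r addr0.
  have : s * `|y - x0| < s * d by rewrite ltr_pM2l // lt0r s_neq0.
  have : (1 - s) * `|y' - x0| <= (1 - s) * d.
    by rewrite ler_wpM2l ?subr_ge0 // ltW.
  lra.
have seg' (s : R) (s01 : s \in `[0, 1]) : ball_ Num.norm x0 d (y' + s *: (y - y')).
  by rewrite /ball_ /= distrC; exact: seg.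
have dg (s : R) : s \in `[0, 1] -> is_derive s (1 : R)
    (phi \o (fun s => y' + s *: (y - y')))
    (dot (grad phi (y' + s *: (y - y'))) (y - y')).
  move=> s01; have [Us _] := dH _ (seg' s s01).
  rewrite -derive_grad; last exact: dphi.
  by apply: is_derive_curve_comp; [exact: dphi | exact: is_derive_line].
pose g := phi \o (fun s : R => y' + s *: (y - y')).
pose g' := fun s : R => dot (grad phi (y' + s *: (y - y'))) (y - y').
have dg_oo (s : R) : s \in `]0, 1[ -> is_derive s (1 : R) g (g' s).
  by move=> /subset_itv_oo_cc; exact: dg.
have cg : {within `[0, 1], continuous g}.
  apply: derivable_within_continuous => s s01.
  by have ds := dg s s01.
have [s s01] := MVT_segment ler01 dg_oo cg; rewrite /g /g' /=.
rewrite scale1r scale0r addr0 subrKC subr0 mulr1 => ->.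
rewrite -dotBl dotC.
have [_ Hs] := dH _ (seg' s s01).
apply: (@le_trans _ _ (n%:R * c' * `|y - y'|)).
  by apply: dot_norm_le => i; rewrite !mxE.
rewrite ler_wpM2r // /c' mulrCA ler_piMr ?(ltW c0) //.
by rewrite ler_pdivrMr ?ltr0n // mul1r ler_nat.
Unshelve. all: by end_near. Qed.

End C1.

(** * First-order behaviour of a real function at 0 *)

Lemma is_derive_first_order {R : realType} (q : R -> R) d : is_derive (0 : R) (1 : R) q d ->
  forall e, 0 < e -> \forall h \near (0 : R), `|q h - q 0 - h * d| <= e * `|h|.
Proof.
move=> [dq dE] e e0.
have : \forall h \near (0 : R)^', `|d - h^-1 *: (q (h *: 1 + 0) - q 0)| <= e.
  by rewrite -dE; have /cvgrPdist_le := dq; apply.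
rewrite near_withinE; apply: filterS => h /= qh.
have [->|h0] := eqVneq h 0; first by rewrite subrr mul0r subrr !normr0 mulr0.
have := qh h0; rewrite addr0 [h *: 1]mulr1 -(ler_pM2r (_ : 0 < `|h|)) ?normr_gt0//.
by rewrite -normrM mulrBl [_ *: _ * _]mulrAC mulVf // mul1r distrC mulrC; exact.
Qed.

Lemma is_derive_local_min {R : realType} (q : R -> R) d : is_derive (0 : R) (1 : R) q d ->
  (\forall h \near (0 : R), q 0 <= q h) -> d = 0.
Proof.
move=> dq qmin; apply/eqP; apply: contraT => d0.
have dn : 0 < `|d| by rewrite normr_gt0.
have [r /= r0 H] : exists2 r : R, 0 < r & forall h, `|h| < r ->
    q 0 <= q h /\ `|q h - q 0 - h * d| <= `|d| / 2 * `|h|.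
  have : \forall h \near (0 : R), q 0 <= q h /\ `|q h - q 0 - h * d| <= `|d| / 2 * `|h|.
    by near=> h; split; near: h => //; apply: is_derive_first_order => //; rewrite divr_gt0.
  move=> /nbhs_normP[r r0 H]; exists r => // h hr; apply: H.
  by rewrite /ball_ /= sub0r normrN.
(* A step against the sign of [d]: the linear term is [- (r / 2 * |d|)] and the error at most half
   of that, so [q h] drops below [q 0]. *)
pose h := - Num.sg d * (r / 2).
have hn : `|h| = r / 2.
  by rewrite normrM normrN normr_sg d0 mul1r gtr0_norm ?divr_gt0.
have hd : h * d = - (r / 2 * `|d|).
  by rewrite /h mulNr mulNr mulrAC mulrC mulrAC -normrEsg; lra.
have [] := H h; first by rewrite hn; lra.
rewrite hn hd => qh /ler_normlP[_].
have : 0 < r * `|d| by rewrite mulr_gt0.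
nra.
Unshelve. all: by end_near. Qed.

Lemma is_derive_neg {R : realType} (q : R -> R) d : is_derive (0 : R) (1 : R) q d ->
  d < 0 -> \forall h \near (0 : R), 0 < h -> q h < q 0.
Proof.
move=> dq d0; have := is_derive_first_order _ _ dq (- d / 2).
rewrite divr_gt0 ?oppr_gt0 // => /(_ isT); apply: filterS => h H h0.
move: H; rewrite (gtr0_norm h0) => /ler_normlP[_].
have : h * d < 0 by rewrite pmulr_rlt0.
nra.
Qed.

(** * Normalized gradients *)

Section UnitGrad.
Context {R : realType} {n : nat}.
Implicit Types (U : set 'rV[R]_n) (phi : 'rV[R]_n -> R).

Definition unit_grad phi y : 'rV[R]_n := (enorm (grad phi y))^-1 *: grad phi y.

Lemma unit_grad_norm phi y : grad phi y != 0 -> dot (unit_grad phi y) (unit_grad phi y) = 1.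
Proof.
move=> g0; rewrite dotZl dotZr dot_enorm; field.
by rewrite enorm_eq0.
Qed.

(** One order of differentiability is spent on the gradient; its nonvanishing keeps the argument of
    1 / sqrt positive, where that function is C^1. *)
Lemma C1_unit_grad U phi j : open U -> Ck_on 2 U phi ->
  (forall y, U y -> grad phi y != 0) -> Ck_on 1 U (fun y => unit_grad phi y 0 j).
Proof.
move=> oU [_ Cphi] g0.
have Cg k : Ck_on 1 U (fun y => grad phi y 0 k).
  by rewrite (_ : (fun y => _) = 'D_(delta_mx 0 k) phi) //; apply/funext => y; rewrite mxE.
pose h t : R := (Num.sqrt t)^-1.
(* The derivative of 1 / sqrt, in the shape that the rule for inverses produces. *)
pose dh t : R := - (Num.sqrt t) ^- 2 *: (2 * Num.sqrt t)^-1.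
pose s y := dot (grad phi y) (grad phi y).
have s0 y : U y -> 0 < s y.
  by move=> Uy; rewrite lt0r dot_ge0 dot_eq0 g0.
rewrite (_ : (fun y => _) = (fun y => (h \o s) y * grad phi y 0 j)); last first.
  by apply/funext => y; rewrite mxE.
apply: C1_mul => //; apply: (@C1_comp_real _ _ _ _ _ dh) => //.
- by apply: C1_sum => // k; exact: C1_mul.
- move=> x /s0 sx; have := is_derive1_sqrt sx => ds.
  by apply: is_deriveV; rewrite sqrtr_eq0 -ltNge.
- move=> x /s0 sx; have sq0 : Num.sqrt (s x) != 0 by rewrite sqrtr_eq0 -ltNge.
  have cs : Num.sqrt @ s x --> Num.sqrt (s x) by exact: sqrt_continuous.
  have c1 : (fun t => (Num.sqrt t ^+ 2)^-1) @ s x --> (Num.sqrt (s x) ^+ 2)^-1.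
    apply: cvgV; first by rewrite expf_neq0.
    exact: (cvgM cs cs).
  have c2 : (fun t => (2 * Num.sqrt t)^-1) @ s x --> (2 * Num.sqrt (s x))^-1.
    apply: cvgV; first by rewrite mulf_neq0.
    exact: cvgMr.
  exact: (cvgM (cvgN c1) c2).
Qed.

End UnitGrad.

(** * Distance, nearest points and normality *)

Section NearestPoint.
Context {R : realType} {n : nat}.
Implicit Types (S : set 'rV[R]_n) (x y z v : 'rV[R]_n).

Lemma dist_le S z x : S x -> dist S z <= enorm (x - z).
Proof.
move=> Sx; apply: ge_inf; last by exists x.
by exists 0 => _ [y _ <-]; exact: enorm_ge0.
Qed.

Lemma dist_nearest S z y : nearest S z y -> dist S z = enorm (y - z).
Proof.
move=> [Sy ymin]; apply/eqP; rewrite eq_le dist_le //=.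
apply: lb_le_inf; first by exists (enorm (y - z)); exists y.
by move=> _ [x Sx <-]; exact: ymin.
Qed.

(** As [eps] lies below a supremum, some admissible [rho] exceeds it; uniqueness of the nearest
    point then makes the choice by [get] meaningful. *)
Lemma closest_pointP S (eps : R) z : (eps%:E < reach S)%E -> tube S eps z ->
  nearest S z (closest_point S z) /\
  forall y, nearest S z y -> y = closest_point S z.
Proof.
move=> /ereal_sup_gt[_ [rho Hrho <-]]; rewrite lte_fin => eps_rho zt.
have [y [yn yuniq]] := Hrho z (lt_trans zt eps_rho).
have Pn : nearest S z (closest_point S z) by exact: (@getPex _ (nearest S z) (ex_intro _ y yn)).
by split=> // y' /yuniq <-; exact: yuniq.
Qed.

Lemma enorm_continuous : continuous (@enorm R n).
Proof.
move=> v; apply: continuous_comp; last exact: sqrt_continuous.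
have [|d _] := @C1_sum R n setT n (fun i v => v 0 i * v 0 i) openT.
  by move=> i; apply: C1_mul; [exact: openT | exact: C1_coord | exact: C1_coord].
exact: differentiable_continuous (d v I).
Qed.

(** The nearest point of [z] serves as a competitor for all [w] close to [z]. *)
Lemma open_tube S (eps : R) : (eps%:E < reach S)%E -> open (tube S eps).
Proof.
move=> reach_eps; rewrite openE => z zt; have [Pn _] := closest_pointP _ _ _ reach_eps zt.
have zlt : enorm (closest_point S z - z) < eps by rewrite -(dist_nearest _ _ _ Pn).
have : {for z, continuous (fun w : 'rV[R]_n => enorm (closest_point S z - w))}.
  apply: (@continuous_comp _ _ _ (fun w : 'rV[R]_n => closest_point S z - w) enorm).
    have := @cvgB _ _ _ (nbhs z) _ (cst (closest_point S z)) id _ _ (cvg_cst _) cvg_id.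
    exact.
  exact: enorm_continuous.
move=> /cvgr_lt /(_ eps zlt).
apply: filterS => w weps.
exact: le_lt_trans (dist_le S w _ Pn.1) weps.
Qed.

(** The squared distance to [z] along a curve in [S] through [y] is minimal at parameter 0, so its
    derivative vanishes there. *)
Lemma nearest_normal S z y v : nearest S z y -> tangent_space S y v -> dot (z - y) v = 0.
Proof.
move=> [Sy ymin] [c [c0 cS dc]].
pose q s := dot (c s - z) (c s - z).
have dcz : is_derive (0 : R) (1 : R) (fun s => c s - z) v.
  have := is_deriveB dc (is_derive_cst z (0 : R) (1 : R)).
  by rewrite subr0.
have dq := is_derive_dot _ _ _ _ _ dcz dcz.
have /(is_derive_local_min _ _ dq) : \forall s \near (0 : R), q 0 <= q s.
  apply: filterS cS => s cs; rewrite /q !dot_enorm c0.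
  by rewrite ler_pXn2r ?nnegrE ?enorm_ge0 //; exact: ymin.
rewrite c0 (dotC v) -opprB dotNl; lra.
Qed.

End NearestPoint.

Lemma continuous_near {T T' : topologicalType} {f : T -> T'} {x} (U : set T') :
  {for x, continuous f} -> nbhs (f x) U -> \forall y \near x, U (f y).
Proof. by move=> cf; exact: cf. Qed.

Definition defining_function {R : realType} {n : nat} (Om U : set 'rV[R]_n) phi :=
  [/\ open U, smooth_on U phi &
      [/\ forall y, U y -> grad phi y != 0,
          forall y, U y -> (Om y <-> phi y < 0) &
          forall y, U y -> (boundary Om y <-> phi y = 0)]].

(* Two defining functions near y have the same unit gradient there (see
   unit_grad_unique), so the choice made by get does not matter. *)
Definition outward_normal {R : realType} {n : nat} (Om : set 'rV[R]_n) y : 'rV[R]_n :=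
  get [set v | exists U phi, [/\ defining_function Om U phi, U y & v = unit_grad phi y]].

Lemma curve_near {R : realType} {n : nat} (S U : set 'rV[R]_n) x c v :
  open U -> U x -> curve_through S x c v -> \forall s \near (0 : R), U (c s).
Proof.
move=> oU Ux [c0 _ dc]; have dc0 : differentiable c 0 by apply/derivable1_diffP.
apply: (continuous_near _ (differentiable_continuous dc0)); rewrite c0.
exact: open_nbhs_nbhs.
Qed.

(** A defining function is constantly 0 along a curve in the boundary. *)
Lemma tangent_orthogonal_grad {R : realType} {n : nat} (Om U : set 'rV[R]_n) phi y v :
  defining_function Om U phi -> U y -> tangent_space (boundary Om) y v ->
  dot (unit_grad phi y) v = 0.
Proof.
move=> [oU sphi [_ _ phi0]] Uy [c cv]; rewrite dotZl.
have [dphi _] := sphi 1%N; have [c0 cS dc] := cv.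
have dpc : is_derive (0 : R) (1 : R) (phi \o c) (dot (grad phi y) v).
  rewrite -derive_grad -?c0; last by apply: dphi; rewrite c0.
  by apply: is_derive_curve_comp => //; apply: dphi; rewrite c0.
have dpc0 : is_derive (0 : R) (1 : R) (phi \o c) 0.
  apply: (@near_eq_is_derive _ _ _ (cst (0 : R))).
  have := curve_near _ _ _ _ _ oU Uy cv; apply: filterS2 cS => s cs Us.
  by rewrite /= (phi0 _ Us).1.
suff -> : dot (grad phi y) v = 0 by rewrite mulr0.
by rewrite -[LHS]derive_val; exact: derive_val.
Qed.

(** * Local little-o and big-O calculus *)

Section Small.
Context {R : realType} {T : Type} {G : set_system T} {FG : Filter G} (w : T -> R)
  (w_ge0 : forall p, 0 <= w p).
Implicit Types X Y : T -> R.

(** o(w) along the filter, written as an inequality because the [w] used below, [|p.1 - p.2|],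
    vanishes on the diagonal. *)
Definition small X := forall c, 0 < c -> \forall p \near G, `|X p| <= c * w p.

Definition big X := exists2 C, 0 <= C & \forall p \near G, `|X p| <= C * w p.

Lemma small_big X : small X -> big X.
Proof. by move=> sX; exists 1 => //; exact: sX. Qed.

Lemma big_scale a X : big X -> big (fun p => a * X p).
Proof.
move=> [C C0 XC]; exists (`|a| * C); first exact: mulr_ge0.
by apply: filterS XC => p; rewrite normrM -mulrA => /ler_wpM2l; apply.
Qed.

Lemma big_add X Y : big X -> big Y -> big (fun p => X p + Y p).
Proof.
move=> [C C0 XC] [D D0 YD]; exists (C + D); first exact: addr_ge0.
apply: filterS2 XC YD => p Xp Yp; rewrite mulrDl.
by apply: le_trans (ler_normD _ _) _; exact: lerD.
Qed.

Lemma small_add X Y : small X -> small Y -> small (fun p => X p + Y p).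
Proof.
move=> sX sY c c0; have c2 : 0 < c / 2 by rewrite divr_gt0.
apply: filterS2 (sX _ c2) (sY _ c2) => p Xp Yp.
by rewrite (splitr c) mulrDl; apply: le_trans (ler_normD _ _) _; exact: lerD.
Qed.

Lemma small_mul X Y : big X -> Y @ G --> (0 : R) -> small (fun p => X p * Y p).
Proof.
move=> [C C0 XC] /cvgr0Pnorm_le Y0 c c0.
(* [C] may be 0, hence the denominator [C + 1]. *)
have cC : 0 < c / (C + 1) by rewrite divr_gt0 // ltr_wpDl.
apply: filterS2 XC (Y0 _ cC) => p Xp Yp.
rewrite normrM; apply: (@le_trans _ _ (C * w p * (c / (C + 1)))).
  by apply: ler_pM.
have -> : C * w p * (c / (C + 1)) = c * w p * (C / (C + 1)) by ring.
by rewrite ler_piMr ?mulr_ge0 ?(ltW c0) // ler_pdivrMr ?ltr_wpDl // mul1r lerDl.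
Qed.

Lemma small_scale a X : small X -> small (fun p => a * X p).
Proof.
move=> sX c c0; have ca : 0 < c / (`|a| + 1) by rewrite divr_gt0 // ltr_wpDl.
apply: filterS (sX _ ca) => p Xp.
rewrite normrM; apply: (le_trans (ler_wpM2l (normr_ge0 a) Xp)).
have -> : `|a| * (c / (`|a| + 1) * w p) = c * w p * (`|a| / (`|a| + 1)) by ring.
by rewrite ler_piMr ?mulr_ge0 ?(ltW c0) // ler_pdivrMr ?ltr_wpDl // mul1r lerDl.
Qed.

Lemma small_sum k (X : 'I_k -> T -> R) : (forall i, small (X i)) ->
  small (fun p => \sum_i X i p).
Proof.
move=> sX; have -> : (fun p => \sum_i X i p) = \sum_i X i.
  by apply/funext => p; rewrite fct_sumE.
elim/big_ind : _ => // [c c0|F F' sF sF']; last exact: small_add.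
by near=> p; rewrite normr0 mulr_ge0 // ltW.
Unshelve. all: by end_near. Qed.

Lemma small_near_eq X Y : (\forall p \near G, X p = Y p) -> small Y -> small X.
Proof. by move=> XY sY c c0; apply: filterS2 XY (sY c c0) => p ->. Qed.

End Small.

(** Expand [v] in the frame: id + eta L rescales each [t j], so only [j = i] and the [nu] component
    survive against [t i]. The cross term has to stay, since for [L] the derivative of a unit
    gradient, [L nu] may have a tangential part. *)
Lemma frame_perturbation {R : realType} {m : nat} {t : 'I_m -> 'rV[R]_m.+1}
    {nu : 'rV[R]_m.+1} {sigma : 'I_m -> R} {eta : R}
    (L : {linear 'rV[R]_m.+1 -> 'rV[R]_m.+1}) :
  (forall i j, dot (t i) (t j) = (i == j)%:R) -> dot nu nu = 1 ->
  (forall i, dot nu (t i) = 0) ->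
  (forall i, t i + eta *: L (t i) = (sigma i)^-1 *: t i) ->
  forall i v, dot v (t i) + eta * dot (L v) (t i) =
    (sigma i)^-1 * dot v (t i) + eta * dot (L nu) (t i) * dot nu v.
Proof.
move=> t_orthonormal nn nt shape i v.
pose E v := v + eta *: L v.
have EZ a b : E (a *: b) = a *: E b.
  by rewrite /E linearZ /= scalerDr !scalerA mulrC.
have ED a b : E (a + b) = E a + E b by rewrite /E linearD /= scalerDr addrACA.
have Et j : E (t j) = (sigma j)^-1 *: t j := shape j.
have E0 : E 0 = 0 by have := EZ 0 0; rewrite !scale0r.
have -> : dot v (t i) + eta * dot (L v) (t i) = dot (E v) (t i).
  by rewrite dotDl dotZl.
rewrite {1}(orthonormal_expansion t_orthonormal nn nt v).
rewrite ED EZ (big_morph E ED E0) dotDl dotZl dot_suml (bigD1 i) //= big1; last first.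
  by move=> j ji; rewrite EZ Et !dotZl t_orthonormal (negbTE ji) !mulr0.
rewrite EZ Et !dotZl t_orthonormal eqxx /E dotDl nt dotZl (dotC v nu).
by rewrite /=; ring.
Qed.

(** * Local injectivity of (y, k) |-> y + k N(y) *)

Section NormalMap.
Context {R : realType} {m : nat} {Om U : set 'rV[R]_m.+1} {phi : 'rV[R]_m.+1 -> R}.
Context (D : defining_function Om U phi) {x0 : 'rV[R]_m.+1} (Ux0 : U x0)
  {t : 'I_m -> 'rV[R]_m.+1} {sigma : 'I_m -> R} {eta : R}
  (t_orthonormal : forall i j, dot (t i) (t j) = (i == j)%:R)
  (t_tangent : forall i, dot (unit_grad phi x0) (t i) = 0)
  (sigma_gt0 : forall i, 0 < sigma i)
  (shape : forall i, t i + eta *: 'D_(t i) (unit_grad phi) x0 = (sigma i)^-1 *: t i).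
Local Notation V := 'rV[R]_m.+1.
Local Notation N := (unit_grad phi).

Let oU : open U.
Proof. by case: D. Qed.

Lemma C1_unit_grad_coord j : Ck_on 1 U (fun y => N y 0 j).
Proof. by case: D => _ sphi [g0 _ _]; apply: C1_unit_grad. Qed.

Lemma unit_grad_differentiable y : U y -> differentiable N y.
Proof. by move=> Uy; apply: differentiable_rV => j; exact: (C1_unit_grad_coord j).1. Qed.

Let N0_norm : dot (N x0) (N x0) = 1.
Proof. by case: D => _ _ [g0 _ _]; apply: unit_grad_norm; exact: g0. Qed.

(** Pairs of boundary points near [(x0, x0)] whose normal lines meet at the offset [eta] of the
    first point. As a filter it makes injectivity the eventual statement [p.1 = p.2]; [k] is left
    unrestricted. *)
Let G : set_system (V * V) := within
  [set p | [/\ boundary Om p.1, boundary Om p.2 &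
    exists k, p.1 + eta *: N p.1 = p.2 + k *: N p.2]] (nbhs (x0, x0)).
Let w (p : V * V) := `|p.1 - p.2|.

Let near_pair (Q : V -> Prop) : (\forall y \near x0, Q y) ->
  \forall p \near G, Q p.1 /\ Q p.2.
Proof.
move=> Qx; apply: (cvg_within (F := nbhs (x0, x0))).
by exists (Q, Q) => // p [].
Qed.

Let strict f : Ck_on 1 U f ->
  small (G := G) w (fun p => f p.1 - f p.2 - dot (grad f x0) (p.1 - p.2)).
Proof.
move=> Cf c c0; have [d d0 dH] := C1_strictly_differentiable _ _ _ oU Cf Ux0 c c0.
have : \forall y \near x0, `|y - x0| < d.
  by apply/nbhs_normP; exists d => // y; rewrite /ball_ /= distrC.
by move=> /near_pair; apply: filterS => p [p1 p2]; exact: dH.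
Qed.

Let big_dot v : big (G := G) w (fun p => dot v (p.1 - p.2)).
Proof.
exists (m.+1%:R * `|v|); first by rewrite mulr_ge0.
by near=> p; rewrite dotC; apply: dot_norm_le => i; exact: coord_norm.
Unshelve. all: by end_near. Qed.

Let w_ge0 p : 0 <= w p. Proof. exact: normr_ge0. Qed.

Let inG : \forall p \near G, [/\ U p.1, U p.2, boundary Om p.1, boundary Om p.2 &
  exists k, p.1 + eta *: N p.1 = p.2 + k *: N p.2].
Proof.
have [p1 p2] : (\forall p \near G, U p.1 /\ U p.2) /\ (\forall p \near G,
    [/\ boundary Om p.1, boundary Om p.2 &
    exists k, p.1 + eta *: N p.1 = p.2 + k *: N p.2]).
  split; last exact: withinT.
  by apply: near_pair; exact: open_nbhs_nbhs.
by apply: filterS2 p1 p2 => p [? ?] [].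
Qed.

(** [phi] vanishes at both points, so strict differentiability bounds its linear part alone. *)
Let small_normal : small (G := G) w (fun p => dot (N x0) (p.1 - p.2)).
Proof.
rewrite (_ : (fun p => _) =
    fun p => (enorm (grad phi x0))^-1 * dot (grad phi x0) (p.1 - p.2)); last first.
  by apply/funext => p; rewrite dotZl.
apply: small_scale => // c c0; have [_ sphi [_ _ phi0]] := D.
apply: filterS2 (strict _ (sphi 1%N) c c0) inG => p + [U1 U2 G1 G2 _].
by rewrite (phi0 _ U1).1 // (phi0 _ U2).1 // subrr sub0r normrN.
Qed.

Let derive_N v : 'D_v N x0 = \row_k dot (grad (fun y => N y 0 k) x0) v.
Proof.
apply/rowP => k; rewrite mxE derive_coord; last exact: unit_grad_differentiable.
by rewrite derive_grad //; exact: (C1_unit_grad_coord k).1.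
Qed.

Let shape_dot i v : dot v (t i) + eta * dot ('D_v N x0) (t i) =
  (sigma i)^-1 * dot v (t i) + eta * dot ('D_(N x0) N x0) (t i) * dot (N x0) v.
Proof.
have dN := unit_grad_differentiable _ Ux0.
have shape' j : t j + eta *: 'd N x0 (t j) = (sigma j)^-1 *: t j.
  by rewrite -(deriveE _ dN).
rewrite !(deriveE _ dN).
exact: (frame_perturbation ('d N x0) t_orthonormal N0_norm t_tangent shape').
Qed.

Let W (p : V * V) := (p.1 - p.2) + eta *: (N p.1 - N p.2).
Let rho (p : V * V) := N p.1 - N p.2 - 'D_(p.1 - p.2) N x0.

Let small_rho k : small (G := G) w (fun p => rho p 0 k).
Proof.
rewrite (_ : (fun p => _) = fun p => N p.1 0 k - N p.2 0 k -
    dot (grad (fun y => N y 0 k) x0) (p.1 - p.2)).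
  exact: strict (C1_unit_grad_coord k).
by apply/funext => p; rewrite /rho derive_N [LHS]mxE; congr (_ + _); rewrite ?mxE.
Qed.

Let big_W k : big (G := G) w (fun p => W p 0 k).
Proof.
rewrite (_ : (fun p => _) = fun p => dot (delta_mx 0 k) (p.1 - p.2) +
    (eta * dot (grad (fun y => N y 0 k) x0) (p.1 - p.2) + eta * rho p 0 k)).
  apply: big_add => //; apply: big_add; apply: big_scale => //.
  exact: small_big.
apply/funext => p; rewrite dotC dot_delta /rho derive_N !mxE; ring.
Qed.

(** By the defining condition of [G], [W p] equals [(k - eta) *: N p.2]; expressing the factor as an
    inner product removes [k]. *)
Let W_parallel : \forall p \near G, W p = dot (W p) (N p.2) *: N p.2.
Proof.
apply: filterS inG => p [_ U2 _ _ [k E]].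
have [_ _ [g0 _ _]] := D.
suff -> : W p = (k - eta) *: N p.2 by rewrite dotZl unit_grad_norm ?mulr1 //; exact: g0.
rewrite /W scalerBr addrACA E scalerBl; apply/rowP => j; rewrite !mxE; ring.
Qed.

(** [W] is O(w), and [W_parallel] lets its pairing with [t i] carry the factor [dot (N p.2) (t i)],
    which tends to [dot (N x0) (t i) = 0]. *)
Let small_W i : small (G := G) w (fun p => dot (W p) (t i)).
Proof.
apply: (@small_near_eq _ _ _ _ _ _ (fun p => \sum_k W p 0 k *
    (N p.2 0 k * dot (N p.2) (t i)))).
  apply: filterS W_parallel => p {1}->; rewrite dotZl /dot mulr_suml.
  by apply: eq_bigr => k _; rewrite mulrA.
apply: small_sum => // k; apply: small_mul => //.
pose q y := N y 0 k * dot (N y) (t i).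
have [dq _] : Ck_on 1 U q.
  apply: C1_mul => //; first exact: C1_unit_grad_coord.
  apply: C1_sum => // j; apply: C1_mul => //; first exact: C1_unit_grad_coord.
  exact: C1_cst.
have := differentiable_continuous (dq _ Ux0).
rewrite /prop_for /continuous_at {2}/q t_tangent mulr0 => cq.
have Gx0 : (fun p : V * V => p.2) @ G --> x0.
  by move=> Q /near_pair; apply: filterS => p [].
exact: cvg_comp Gx0 cq.
Qed.

(** Replace [N p.1 - N p.2] in [W] by its linear part plus [rho], then solve [shape_dot] for the
    tangential component: every other term is o(w), and [(sigma i)^-1] is invertible. *)
Let small_tangent i : small (G := G) w (fun p => dot (p.1 - p.2) (t i)).
Proof.
rewrite (_ : (fun p => _) = fun p => sigma i * (dot (W p) (t i) +
    (- eta * \sum_k t i 0 k * rho p 0 k +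
    - (eta * dot ('D_(N x0) N x0) (t i)) * dot (N x0) (p.1 - p.2)))).
  apply: small_scale => //; apply: small_add => //; apply: small_add.
    by apply: small_scale => //; apply: small_sum => // k; exact: small_scale.
  exact: small_scale.
apply/funext => p; have := shape_dot i (p.1 - p.2).
have -> : \sum_k t i 0 k * rho p 0 k = dot (rho p) (t i) by rewrite dotC.
have s0 : sigma i != 0 by rewrite gt_eqF.
have alg (s a b d e k : R) : s != 0 -> a + eta * b = s^-1 * a + eta * e * k ->
    a = s * ((a + eta * d) + (- eta * (d - b) + - (eta * e) * k)).
  move=> sn0 H; have -> : (a + eta * d) + (- eta * (d - b) + - (eta * e) * k) =
    (a + eta * b) - eta * e * k by ring.
  by rewrite H addrK mulrA divff // mul1r.
by rewrite /W /rho (dotDl (p.1 - p.2)) dotZl (dotBl _ ('D_(p.1 - p.2) N x0)); exact: alg.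
Qed.

(* Write d = p.1 - p.2. Strict differentiability of phi makes the normal component
   of d small with respect to d; strict differentiability of N and the
   invertibility of id + eta DN on the frame t do the same for its tangential
   components. *)
Lemma normal_map_injective : \forall p \near G, p.1 = p.2.
Proof.
have sd k : small (G := G) w (fun p => (p.1 - p.2) 0 k).
  rewrite (_ : (fun p => _) = fun p => N x0 0 k * dot (N x0) (p.1 - p.2) +
      \sum_i t i 0 k * dot (p.1 - p.2) (t i)).
    apply: small_add; first exact: small_scale.
    by apply: small_sum => // i; exact: small_scale.
  apply/funext => p.
  rewrite {1}(orthonormal_expansion t_orthonormal N0_norm t_tangent (p.1 - p.2)).
  rewrite mxE summxE mxE mulrC (dotC _ (N x0)); congr (_ + _).
  by apply: eq_bigr => i _; rewrite mxE mulrC.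
(* Any factor below 1 would do: [w p <= 2^-1 * w p] forces [w p = 0]. *)
have : \forall p \near G, forall k, `|((p : V * V).1 - p.2) 0 k| <= 2^-1 * w p.
  by apply: filter_forall => k; apply: sd; rewrite invr_gt0.
apply: filterS => p /norm_le_coord; rewrite mulr_ge0 ?invr_ge0 // => /(_ isT).
rewrite -/(w p) => H; apply/eqP; rewrite -subr_eq0 -normr_eq0 eq_le normr_ge0 andbT.
by move: H; rewrite /w; lra.
Qed.

End NormalMap.

(** * The tube around the boundary *)

Section Tube.
Context {R : realType} {m : nat} {Om : set 'rV[R]_m.+1} {eps : R}.
Local Notation V := 'rV[R]_m.+1.
Let Gam := boundary Om.
Let P := closest_point Gam.
Context (Om_smooth : smooth_boundary Om) (eps_gt0 : 0 < eps)
  (eps_reach : (eps%:E < reach Gam)%E)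
  (P_diff : forall z, tube Gam eps z -> differentiable P z)
  {t : V -> 'I_m -> V} {sigma : V -> 'I_m -> R}
  (t_orthonormal : forall z, tube Gam eps z ->
    forall i j, dot (t z i) (t z j) = (i == j)%:R)
  (sigma_gt0 : forall z, tube Gam eps z -> forall i, 0 < sigma z i)
  (P_jacobian : forall z, tube Gam eps z ->
    'J P z = \sum_i sigma z i *: outer (t z i) (t z i)).

Lemma closest_point_in z : tube Gam eps z -> Gam (P z).
Proof. by move=> /(closest_pointP _ _ _ eps_reach)[[]]. Qed.

Lemma tube_nbhs z : tube Gam eps z -> \forall w \near z, tube Gam eps w.
Proof. by move=> zt; apply: open_nbhs_nbhs; split=> //; exact: open_tube. Qed.

Lemma boundary_tube y : Gam y -> tube Gam eps y.
Proof.
move=> Gy; apply: le_lt_trans (dist_le _ _ _ Gy) _.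
by rewrite subrr (eqP (_ : enorm 0 == 0)) // enorm_eq0.
Qed.

Lemma closest_point_id y : Gam y -> P y = y.
Proof.
move=> Gy; have [_ P_uniq] := closest_pointP _ _ _ eps_reach (boundary_tube _ Gy).
apply/esym/P_uniq; split=> // x _; rewrite subrr (eqP (_ : enorm 0 == 0)) ?enorm_ge0 //.
by rewrite enorm_eq0.
Qed.

Lemma defining_function_at y : Gam y ->
  exists U phi, defining_function Om U phi /\ U y.
Proof.
by move=> /Om_smooth[U [phi [oU Uy sphi H]]]; exists U, phi; split.
Qed.

Lemma derive_closest_point z v : tube Gam eps z ->
  is_derive (0 : R) (1 : R) (fun s : R => P (z + s *: v))
    (\sum_i (sigma z i * dot v (t z i)) *: t z i).
Proof.
move=> zt; have z0 : z + (0 : R) *: v = z by rewrite scale0r addr0.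
have -> : \sum_i (sigma z i * dot v (t z i)) *: t z i = 'D_v P (z + (0 : R) *: v).
  rewrite z0 deriveEjacobian ?P_jacobian //; last exact: P_diff.
  rewrite mulmx_sumr; apply: eq_bigr => i _.
  by rewrite -scalemxAr mulmx_outer scalerA.
apply: (is_derive_curve_comp P (fun s : R => z + s *: v)).
  by rewrite z0; exact: P_diff.
exact: is_derive_line.
Qed.

Lemma near_line z v : tube Gam eps z ->
  \forall s \near (0 : R), tube Gam eps (z + s *: v).
Proof.
move=> zt.
have dl : differentiable (fun s : R => z + s *: v) 0.
  by apply/derivable1_diffP; have := is_derive_line z v 0.
apply: (continuous_near _ (differentiable_continuous dl)).
by rewrite scale0r addr0; exact: tube_nbhs.
Qed.

(** P maps into the boundary and P' multiplies [t z i] by [sigma z i]. Dividing the coefficients by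
    [sigma] therefore gives a line whose image under P has the prescribed velocity. This makes the
    frame attached to [z] tangent to the boundary at [P z]. *)
Lemma frame_tangent z (a : 'I_m -> R) : tube Gam eps z ->
  tangent_space Gam (P z) (\sum_i a i *: t z i).
Proof.
move=> zt; pose v := \sum_i (a i / sigma z i) *: t z i.
exists (fun s : R => P (z + s *: v)); split.
- by rewrite scale0r addr0.
- by have := near_line _ v zt; apply: filterS => s; exact: closest_point_in.
- apply: is_derive_eq; first exact: derive_closest_point.
  apply: eq_bigr => i _; congr (_ *: _).
  rewrite dot_suml (bigD1 i) //= big1 ?addr0 => [|j ji].
    rewrite dotZl t_orthonormal // eqxx mulr1 mulrC divfK //.
    by rewrite gt_eqF // sigma_gt0.
  by rewrite dotZl t_orthonormal // (negbTE ji) mulr0.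
Qed.

Lemma frame_tangent1 z i : tube Gam eps z -> tangent_space Gam (P z) (t z i).
Proof.
move=> zt; rewrite -[t z i](_ : \sum_j (i == j)%:R *: t z j = _).
  exact: frame_tangent.
rewrite (bigD1 i) //= eqxx scale1r big1 ?addr0 // => j /negbTE.
by rewrite eq_sym => ->; rewrite scale0r.
Qed.

Lemma normal_expansion z nu w : tube Gam eps z -> dot nu nu = 1 ->
  (forall v, tangent_space Gam (P z) v -> dot nu v = 0) ->
  w = dot w nu *: nu + \sum_i dot w (t z i) *: t z i.
Proof.
move=> zt nn nt; apply: orthonormal_expansion => //; first exact: t_orthonormal.
by move=> i; apply: nt; exact: frame_tangent1.
Qed.

(** The frame supplies [m] orthonormal tangent vectors in dimension [m.+1], so the normal directions
    form a line. *)
Lemma normal_vector z nu w : tube Gam eps z -> dot nu nu = 1 ->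
  (forall v, tangent_space Gam (P z) v -> dot nu v = 0) ->
  (forall v, tangent_space Gam (P z) v -> dot w v = 0) ->
  w = dot w nu *: nu.
Proof.
move=> zt nn nt wt; rewrite {1}(normal_expansion z nu w zt nn nt).
rewrite big1 ?addr0 // => i _.
by rewrite wt ?scale0r //; exact: frame_tangent1.
Qed.

(** * The outward normal field and normal coordinates *)

Lemma unit_grad_unique U1 U2 phi1 phi2 y :
  defining_function Om U1 phi1 -> defining_function Om U2 phi2 ->
  U1 y -> U2 y -> Gam y -> unit_grad phi1 y = unit_grad phi2 y.
Proof.
move=> D1 D2 U1y U2y Gy; have yt := boundary_tube y Gy; have Py := closest_point_id y Gy.
have [oU1 s1 [g1 neg1 zero1]] := D1; have [oU2 s2 [g2 neg2 zero2]] := D2.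
set n1 := unit_grad phi1 y; set n2 := unit_grad phi2 y.
have nn1 : dot n1 n1 = 1 by apply: unit_grad_norm; exact: g1.
have nn2 : dot n2 n2 = 1 by apply: unit_grad_norm; exact: g2.
(* As [P y = y], the frame at [y] is tangent at [y] itself, so two unit normals there agree up to
   sign; only the sign remains to be settled. *)
have E : n1 = dot n1 n2 *: n2.
  apply: (normal_vector y) => // v; rewrite Py.
    exact: (tangent_orthogonal_grad _ _ _ _ _ D2 U2y).
  exact: (tangent_orthogonal_grad _ _ _ _ _ D1 U1y).
have c2 : dot n1 n2 ^+ 2 = 1.
  by move: nn1; rewrite {1 2}E dotZl dotZr nn2 mulr1 expr2.
have /eqP := c2; rewrite sqrf_eq1 => /orP[/eqP c1|/eqP cN1].
  by rewrite E c1 scale1r.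
have gradE phi : grad phi y != 0 -> grad phi y = enorm (grad phi y) *: unit_grad phi y.
  by move=> g0; rewrite scalerA divff ?scale1r // enorm_eq0.
have l0 s : y + (0 : R) *: s = y by rewrite scale0r addr0.
have dl phi (s : V) U : U y -> smooth_on U phi ->
    is_derive (0 : R) (1 : R) (fun h : R => phi (y + h *: s)) (dot (grad phi y) s).
  move=> Uy sphi; have [dphi _] := sphi 1%N.
  rewrite -derive_grad; last exact: dphi.
  have dp : differentiable phi (y + (0 : R) *: s) by rewrite l0; exact: dphi.
  by have := is_derive_curve_comp _ _ _ _ dp (is_derive_line y s 0); rewrite l0.
have pos phi : grad phi y != 0 -> 0 < enorm (grad phi y).
  by move=> g0; rewrite lt0r enorm_eq0 g0 enorm_ge0.
(* Along n2 = - n1 the first function decreases, so we enter Om, whereas the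
   second one increases. *)
have := is_derive_neg _ _ (dl phi1 n2 U1 U1y s1).
rewrite (gradE phi1) ?g1 // dotZl -/n1 cN1 mulrN1 oppr_lt0 pos ?g1 // => /(_ isT) H1.
have := is_derive_neg _ _ (is_deriveN (dl phi2 n2 U2 U2y s2)).
rewrite (gradE phi2) ?g2 // dotZl -/n2 nn2 mulr1 oppr_lt0 pos ?g2 // => /(_ isT) H2.
have near_U U : open U -> U y -> \forall h \near (0 : R), U (y + h *: n2).
  move=> oU Uy; have dn : differentiable (fun h : R => y + h *: n2) 0.
    by apply/derivable1_diffP; have := is_derive_line y n2 0.
  apply: (continuous_near _ (differentiable_continuous dn)).
  by rewrite l0; exact: open_nbhs_nbhs.
have H : \forall h \near (0 : R), 0 < h -> False.
  have N1 := near_U _ oU1 U1y; have N2 := near_U _ oU2 U2y.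
  apply: filterS2 (filterI N1 N2) (filterI H1 H2) => h [U1h U2h] [H1h H2h] h0.
  have L : - phi2 (y + h *: n2) < - phi2 (y + 0 *: n2) by exact: H2h.
  have := H1h h0; move: L.
  rewrite !l0 (zero1 _ U1y).1 // (zero2 _ U2y).1 // oppr0 oppr_lt0 => p2.
  by move=> /(neg1 _ U1h).2 /(neg2 _ U2h).1 /(lt_trans p2); rewrite ltxx.
move/nbhs_normP : H => [d d0 Hd]; exfalso; apply: (Hd (d / 2)); last by rewrite divr_gt0.
by rewrite /ball_ /= sub0r normrN gtr0_norm ?divr_gt0 // ltr_pdivrMr // ltr_pMr // ltr1n.
Qed.

Lemma outward_normalE U phi y : defining_function Om U phi -> U y -> Gam y ->
  outward_normal Om y = unit_grad phi y.
Proof.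
move=> D Uy Gy; have [U' [phi' [D' Uy' ->]]] : [set v | exists U phi,
    [/\ defining_function Om U phi, U y & v = unit_grad phi y]] (outward_normal Om y).
  exact: (@getPex _ _ (ex_intro _ (unit_grad phi y) (ex_intro _ U (ex_intro _ phi _)))).
exact: (unit_grad_unique _ _ _ _ _ D' D Uy' Uy Gy).
Qed.

Lemma outward_normal_norm y : Gam y -> dot (outward_normal Om y) (outward_normal Om y) = 1.
Proof.
move=> Gy; have [U [phi [D Uy]]] := defining_function_at y Gy.
rewrite (outward_normalE U phi) //; apply: unit_grad_norm.
by have [_ _ [g0 _ _]] := D; exact: g0.
Qed.

Lemma outward_normal_tangent y v : Gam y -> tangent_space Gam y v ->
  dot (outward_normal Om y) v = 0.
Proof.
move=> Gy; have [U [phi [D Uy]]] := defining_function_at y Gy.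
by rewrite (outward_normalE U phi) //; exact: (tangent_orthogonal_grad _ _ _ _ _ D Uy).
Qed.

(** Taken from the normal field instead of [signed_dist], so that the decomposition of [z] is linear
    algebra and its sign comes with the orientation of the normal. *)
Definition normal_coordinate z := dot (z - P z) (outward_normal Om (P z)).

Lemma tube_decomposition z : tube Gam eps z ->
  z = P z + normal_coordinate z *: outward_normal Om (P z).
Proof.
move=> zt; have Gz := closest_point_in z zt.
rewrite -(normal_vector z (outward_normal Om (P z)) (z - P z)) //.
- by rewrite addrC subrK.
- exact: outward_normal_norm.
- by move=> v; exact: outward_normal_tangent.
- have [Pn _] := closest_pointP _ _ _ eps_reach zt.
  by move=> v; exact: nearest_normal.
Qed.

Lemma normal_coordinate_lt z : tube Gam eps z -> `|normal_coordinate z| < eps.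
Proof.
move=> zt; have [Pn _] := closest_pointP _ _ _ eps_reach zt.
have : dist Gam z < eps by [].
rewrite (dist_nearest _ _ _ Pn) {2}(tube_decomposition z zt) opprD addrA subrr.
rewrite sub0r -scaleNr enormZ normrN.
have /enorm1 -> := outward_normal_norm _ (closest_point_in _ zt).
by rewrite mulr1.
Qed.

(** With [frame_tangent] this identifies the tangent space at [P z] with the span of the frame at
    [z]. *)
Lemma tangent_expansion z v : tube Gam eps z -> tangent_space Gam (P z) v ->
  v = \sum_i dot v (t z i) *: t z i.
Proof.
move=> zt Tv; have Gz := closest_point_in z zt.
rewrite {1}(normal_expansion z (outward_normal Om (P z)) v zt).
- by rewrite dotC outward_normal_tangent // scale0r add0r.
- exact: outward_normal_norm.
- by move=> w; exact: outward_normal_tangent.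
Qed.

Lemma closest_point_continuous z : tube Gam eps z -> {for z, continuous P}.
Proof. by move=> /P_diff; exact: differentiable_continuous. Qed.

(* Differentiate z = P z + d(z) N(P z) along t_i. As N has unit length, its
   derivative is orthogonal to N, so the derivative of d vanishes. *)
Lemma shape_operator z U phi i : tube Gam eps z -> defining_function Om U phi ->
  U (P z) -> t z i + normal_coordinate z *: 'D_(t z i) (unit_grad phi) (P z) =
    (sigma z i)^-1 *: t z i.
Proof.
move=> zt D Uz; have Gz := closest_point_in z zt; have [oU _ _] := D.
have s0 : sigma z i != 0 by rewrite gt_eqF // sigma_gt0.
pose N := unit_grad phi; pose c s := P (z + s *: t z i).
have z0 : z + (0 : R) *: t z i = z by rewrite scale0r addr0.
have dc : is_derive (0 : R) (1 : R) c (sigma z i *: t z i).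
  apply: is_derive_eq; first exact: derive_closest_point.
  rewrite (bigD1 i) //= big1 ?addr0 => [|j ji]; rewrite t_orthonormal //.
    by rewrite eqxx mulr1.
  by rewrite eq_sym (negbTE ji) mulr0 scale0r.
have c0 : c 0 = P z by rewrite /c z0.
have dN : differentiable N (c 0) by rewrite c0; exact: unit_grad_differentiable D _ Uz.
have dNc := is_derive_curve_comp _ _ _ _ dN dc; rewrite c0 in dN dNc.
have dl := is_derive_line z (t z i) 0.
pose d s := dot (z + s *: t z i - c s) (N (c s)).
have [d' dd] : exists d', is_derive (0 : R) (1 : R) d d'.
  by eexists; apply: is_derive_dot => //; exact: is_deriveB dl dc.
pose DN := 'D_(sigma z i *: t z i) N (P z).
have dR : is_derive (0 : R) (1 : R) (fun s => c s + d s *: N (c s))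
    (sigma z i *: t z i + (d' *: N (P z) + normal_coordinate z *: DN)).
  have d0 : d 0 = normal_coordinate z.
    by rewrite /d z0 c0 /normal_coordinate (outward_normalE U phi).
  have := is_deriveD dc (is_derive_scale _ _ _ _ _ dd dNc).
  by rewrite /= c0 d0.
have cU : \forall s \near (0 : R), tube Gam eps (z + s *: t z i) /\ U (c s).
  apply: filterI; first exact: near_line.
  have dc0 : differentiable c 0 by apply/derivable1_diffP.
  apply: (continuous_near _ (differentiable_continuous dc0)).
  by rewrite c0; exact: open_nbhs_nbhs.
(* Near [s = 0] the same curve is the straight line [z + s *: t z i], by [tube_decomposition];
   comparing with [dR] gives the identity [E]. *)
have dL : is_derive (0 : R) (1 : R) (fun s => c s + d s *: N (c s)) (t z i).
  apply: near_eq_is_derive dl.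
  apply: filterS cU => s [st Us].
  have nE : outward_normal Om (P (z + s *: t z i)) = N (c s).
    exact: outward_normalE _ _ _ D Us (closest_point_in _ st).
  by have := tube_decomposition _ st; rewrite /normal_coordinate nE.
have NN : dot (N (P z)) DN = 0.
  have := is_derive_dot _ _ _ _ _ dNc dNc; rewrite /= c0 -/DN => dNN.
  have dNN1 : is_derive (0 : R) (1 : R) (fun s => dot (N (c s)) (N (c s))) 0.
    apply: (@near_eq_is_derive _ _ _ (cst (1 : R))).
    apply: filterS cU => s [_ Us]; have [_ _ [g0 _ _]] := D.
    by rewrite unit_grad_norm //; exact: g0.
  have := etrans (esym (@derive_val _ _ _ _ _ _ _ dNN)) (@derive_val _ _ _ _ _ _ _ dNN1).
  by rewrite (dotC DN) => /eqP; rewrite -mulr2n mulrn_eq0 /= => /eqP.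
have NT : dot (N (P z)) (t z i) = 0.
  by apply: (tangent_orthogonal_grad _ _ _ _ _ D Uz); exact: frame_tangent1.
have E : t z i = sigma z i *: t z i + (d' *: N (P z) + normal_coordinate z *: DN).
  exact: etrans (esym (@derive_val _ _ _ _ _ _ _ dL)) (@derive_val _ _ _ _ _ _ _ dR).
have N1 : dot (N (P z)) (N (P z)) = 1.
  by have [_ _ [g0 _ _]] := D; apply: unit_grad_norm; exact: g0.
have d'0 : d' = 0.
  have coef (a b : R) (n0 T V' : V) : dot n0 n0 = 1 -> dot n0 V' = 0 ->
      dot n0 T = 0 -> T = a *: T + (d' *: n0 + b *: V') -> d' = 0.
    move=> n1 nV nT /(congr1 (dot n0)).
    by rewrite !dotDr !dotZr n1 nV nT !mulr0 add0r addr0 mulr1.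
  exact: coef N1 NN NT E.
have DNE : DN = sigma z i *: 'D_(t z i) N (P z).
  by rewrite /DN (deriveE _ dN) (deriveE _ dN) linearZ.
have solve (a b : R) (n0 T V' W : V) : a != 0 -> V' = a *: W ->
    T = a *: T + (0 *: n0 + b *: V') -> T + b *: W = a^-1 *: T.
  move=> a0 -> TE; apply: (scalerI a0); rewrite scalerA divff // scale1r {2}TE.
  by rewrite scale0r add0r scalerDr !scalerA mulrC.
apply: solve s0 DNE _; rewrite d'0 in E; exact: E.
Qed.

(** * The offset map and test functions pulled back along it *)

Lemma offset_continuous U phi y eta : defining_function Om U phi -> U y ->
  {for y, continuous (fun x : V => x + eta *: unit_grad phi x)}.
Proof.
move=> D Uy; apply: differentiable_continuous.
apply: differentiableD; first by [].
by apply: differentiableZ; exact: unit_grad_differentiable D _ Uy.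
Qed.

(** The offset of [y] lies in the tube, but its nearest point could a priori differ from [y]; local
    injectivity of the normal map excludes this. The predicate [Q] carries a property holding near
    [z] back to the boundary. *)
Lemma closest_point_offset z (Q : V -> Prop) : tube Gam eps z ->
  (\forall w \near z, Q w) ->
  \forall y \near within Gam (nbhs (P z)),
    [/\ tube Gam eps (y + normal_coordinate z *: outward_normal Om y),
        Q (y + normal_coordinate z *: outward_normal Om y) &
        P (y + normal_coordinate z *: outward_normal Om y) = y].
Proof.
move=> zt Qz; have Gz := closest_point_in z zt.
have [U [phi [D Uz]]] := defining_function_at _ Gz; have [oU _ _] := D.
set eta := normal_coordinate z.
pose F y := y + eta *: unit_grad phi y.
have cF : {for P z, continuous F} by exact: offset_continuous D Uz.
have Fz : F (P z) = z.
  by rewrite [RHS]tube_decomposition // (outward_normalE U phi).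
have inj := normal_map_injective D Uz (t_orthonormal z zt)
  (fun i => tangent_orthogonal_grad _ _ _ _ _ D Uz (frame_tangent1 z i zt))
  (sigma_gt0 z zt) (fun i => shape_operator z U phi i zt D Uz).
have cPF : {for P z, continuous (P \o F)}.
  by apply: continuous_comp => //; rewrite Fz; exact: closest_point_continuous.
have [[A B] [/= nA nB] AB] := inj.
have nU : \forall y \near P z, U y by exact: open_nbhs_nbhs.
(* Injectivity holds on a product neighbourhood [A], [B], so [P (F y)] must also be kept in [B] and
   in [U]; this follows from continuity of [P \o F], as [P (F (P z)) = P z]. *)
have nPF := continuous_near U cPF; rewrite /= Fz in nPF.
have nF := continuous_near _ cF; rewrite Fz in nF.
have nPFB := continuous_near B cPF; rewrite /= Fz in nPFB.
apply: filterS3 (filterI nU (nPF nU)) (filterI nA (nPFB nB))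
  (nF _ (filterI Qz (tube_nbhs _ zt))).
move=> y [Uy UPy] /= [Ay By] [QF tF] Gy; have /= inj_y := AB (y, P (F y)) (conj Ay By).
rewrite (outward_normalE U phi) // -/(F y); split=> //; apply/esym/inj_y.
have GP := closest_point_in _ tF; split=> //.
(* [F y] is the offset of [y] by [eta] and, by [tube_decomposition], the offset of [P (F y)] by this
   number. *)
exists (normal_coordinate (F y)); rewrite -/(F y) {1}(tube_decomposition _ tF).
by rewrite (outward_normalE U phi _ D UPy GP).
Qed.

Definition offset_fun (eta : R) psi y : R := psi (y + eta *: outward_normal Om y).

Lemma offset_tube y (eta : R) : Gam y -> `|eta| < eps ->
  tube Gam eps (y + eta *: outward_normal Om y).
Proof.
move=> Gy eta_eps; apply: le_lt_trans (dist_le _ _ _ Gy) _.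
rewrite opprD addrA subrr sub0r -scaleNr enormZ normrN.
by have /enorm1 -> := outward_normal_norm _ Gy; rewrite mulr1.
Qed.

(** Test functions must be C^1 on the whole surface, not only near [P z]: the bound on [eta] keeps
    every offset point in the tube, and around each [x] the unit gradient of a defining function
    extends the normal to an open set. *)
Lemma C1_offset_fun (eta : R) psi : `|eta| < eps -> Ck_on 1 (tube Gam eps) psi ->
  C1_surface Gam (offset_fun eta psi).
Proof.
move=> eta_eps Cpsi x Gx.
have [U [phi [D Ux]]] := defining_function_at _ Gx; have [oU _ _] := D.
pose F y := y + eta *: unit_grad phi y.
pose W := [set y | U y /\ tube Gam eps (F y)].
have oW : open W.
  rewrite openE => y [Uy tF]; apply: filterI; first exact: open_nbhs_nbhs.
  have cF : {for y, continuous F} by exact: offset_continuous D Uy.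
  exact: continuous_near _ cF (tube_nbhs _ tF).
exists W, (psi \o F); split=> //.
- split=> //; rewrite /F -(outward_normalE U phi _ D Ux Gx).
  exact: offset_tube.
- apply: C1_comp Cpsi => // [j|y []//].
  rewrite (_ : (fun y => _) = fun y : V => y 0 j + eta * unit_grad phi y 0 j).
    apply: C1_add => //; first exact: C1_coord.
    apply: C1_mul => //; first exact: C1_cst.
    have [dN cN] := C1_unit_grad_coord D j.
    by split=> [y []|i y []] Uy _; [exact: dN | exact: cN].
  by apply/funext => y; rewrite !mxE.
- by move=> y [Uy _] Gy; rewrite /offset_fun (outward_normalE U phi _ D Uy Gy).
Qed.

(** The offset curve has velocity v + eta DN v, which [shape_operator] turns into the sum of the
    components of [v] divided by [sigma]; then apply the chain rule. *)
Lemma derive_offset_fun z psi c v : tube Gam eps z ->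
  differentiable psi z -> curve_through Gam (P z) c v ->
  is_derive (0 : R) (1 : R) (offset_fun (normal_coordinate z) psi \o c)
    (\sum_i dot v (t z i) * ((sigma z i)^-1 * dot (grad psi z) (t z i))).
Proof.
move=> zt dpsi cv; have Gz := closest_point_in z zt.
have [U [phi [D Uz]]] := defining_function_at _ Gz; have [oU _ _] := D.
have [c0 cG dc] := cv; set eta := normal_coordinate z.
have dN0 : differentiable (unit_grad phi) (P z) by exact: unit_grad_differentiable D _ Uz.
have dN : differentiable (unit_grad phi) (c 0) by rewrite c0.
have dF := is_deriveD dc (is_deriveZ eta (is_derive_curve_comp _ _ _ _ dN dc)).
have Fz : c 0 + eta *: unit_grad phi (c 0) = z.
  by rewrite c0 [RHS]tube_decomposition // (outward_normalE U phi).
have dpsi' : differentiable psi ((c + eta *: (unit_grad phi \o c)) 0).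
  by rewrite [X in differentiable _ X]Fz.
have := is_derive_curve_comp _ _ _ _ dpsi' dF.
rewrite [X in 'D__ _ X]Fz c0 => dG.
apply: (@near_eq_is_derive _ _ _ (psi \o (c + eta *: (unit_grad phi \o c)))).
  apply: filterS2 cG (curve_near _ _ _ _ _ oU Uz cv) => s Gs Us.
  by rewrite /= /offset_fun (outward_normalE U phi _ D Us Gs).
apply: is_derive_eq.
rewrite derive_grad //; set L := 'd (unit_grad phi) (P z).
have vT : v = \sum_i dot v (t z i) *: t z i by apply: tangent_expansion => //; exists c.
have -> : v + eta *: 'D_v (unit_grad phi) (P z) =
    \sum_i (dot v (t z i) * (sigma z i)^-1) *: t z i.
  rewrite (deriveE _ dN0) -/L {1 2}vT linear_sum scaler_sumr -big_split /=.
  apply: eq_bigr => i _; rewrite linearZ /= scalerA (mulrC eta) -!scalerA -scalerDr.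
  by rewrite /L -(deriveE _ dN0) (shape_operator _ U phi).
rewrite dot_sumr; apply: eq_bigr => i _; rewrite dotZr mulrA //.
Qed.

(** A tangent [a] is orthogonal to [nu], so [a *m tensorB] reduces to the velocity of the offset
    curve; both sides are then the derivative of [G \o c] at 0. *)
Lemma surface_grad_offset_fun z psi nu mu a : tube Gam eps z ->
  differentiable psi z -> (forall i, dot nu (t z i) = 0) ->
  tangent_space Gam (P z) a ->
  dot (surface_grad Gam (offset_fun (normal_coordinate z) psi) (P z)) a =
  dot (grad psi z) (a *m tensorB (n := m.+1) (t z) nu (sigma z) mu).
Proof.
move=> zt dpsi nut [c cv]; set G := offset_fun _ _.
have Ta : tangent_space Gam (P z) a by exists c.
have [_ gradG] : is_surface_grad Gam G (P z) (surface_grad Gam G (P z)).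
  apply: getPex.
  (* The surface gradient chosen by [get] has to exist; its frame components are read off from
     [derive_offset_fun]. *)
  exists (\sum_i ((sigma z i)^-1 * dot (grad psi z) (t z i)) *: t z i).
  split=> [|c' v c'v]; first exact: frame_tangent.
  rewrite dot_suml; under eq_bigr => i _ do rewrite dotZl (dotC _ v) mulrC.
  exact: derive_offset_fun.
have anu : dot a nu = 0.
  rewrite (tangent_expansion z a zt Ta) dot_suml big1 // => i _.
  by rewrite dotZl (dotC _ nu) nut mulr0.
have -> : a *m tensorB (n := m.+1) (t z) nu (sigma z) mu =
    \sum_i (dot a (t z i) * (sigma z i)^-1) *: t z i.
  rewrite mulmxDr -scalemxAr mulmx_outer anu scale0r scaler0 addr0 mulmx_sumr.
  by apply: eq_bigr => i _; rewrite -scalemxAr mulmx_outer scalerA mulrC.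
rewrite dot_sumr; under eq_bigr => i _ do rewrite dotZr -mulrA.
have d1 := gradG c a cv; have d2 := derive_offset_fun z psi c a zt dpsi cv.
exact: etrans (esym (@derive_val _ _ _ _ _ _ _ d1)) (@derive_val _ _ _ _ _ _ _ d2).
Qed.

(** * Transfer of the Hamiltonian, of local extrema and of the viscosity property *)

Lemma hamiltonian_offset_fun z psi nu mu (f r : V -> V -> R) : tube Gam eps z ->
  differentiable psi z -> (forall i, dot (nu z) (t z i) = 0) ->
  hamiltonian (unit_tangents Gam) r (fun x a => f x a *: a) (P z)
    (surface_grad Gam (offset_fun (normal_coordinate z) psi) (P z)) =
  hamiltonian (fun z => unit_tangents Gam (P z)) (fun z a => r (P z) a)
    (fun z a => f (P z) a *: (a *m tensorB (n := m.+1) (t z) (nu z) (sigma z) mu)) z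
    (grad psi z).
Proof.
move=> zt dpsi nut; congr inf; apply: eq_imagel => a [_ Ta].
by rewrite !dotZr (surface_grad_offset_fun z psi (nu z) mu).
Qed.

Lemma offset_at z (u psi : V -> R) : tube Gam eps z ->
  (u \- offset_fun (normal_coordinate z) psi) (P z) = ((u \o P) \- psi) z.
Proof. by move=> zt; rewrite /offset_fun /= -tube_decomposition. Qed.

(** Since P of the offset of [y] is [y], the difference on the surface at [y] is the difference in
    the tube at the offset point; at [P z] the offset point is [z]. *)
Lemma local_max_offset z (u psi : V -> R) : tube Gam eps z ->
  local_max_on (tube Gam eps) ((u \o P) \- psi) z ->
  local_max_on Gam (u \- offset_fun (normal_coordinate z) psi) (P z).
Proof.
move=> zt; rewrite /local_max_on [in X in X -> _]near_withinE offset_at // => zmax.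
have := closest_point_offset _ _ zt zmax.
by apply: filterS => y [ty /(_ ty) + Py]; rewrite /= Py.
Qed.

Lemma local_min_offset z (u psi : V -> R) : tube Gam eps z ->
  local_min_on (tube Gam eps) ((u \o P) \- psi) z ->
  local_min_on Gam (u \- offset_fun (normal_coordinate z) psi) (P z).
Proof.
move=> zt; rewrite /local_min_on [in X in X -> _]near_withinE offset_at // => zmin.
have := closest_point_offset _ _ zt zmin.
by apply: filterS => y [ty /(_ ty) + Py]; rewrite /= Py.
Qed.

Lemma closest_point_comp_continuous (u : V -> R) :
  {within Gam, continuous u} -> {within tube Gam eps, continuous (u \o P)}.
Proof.
move=> /subspace_continuousP cu; apply/subspace_continuousP => z zt.
have Gz := closest_point_in z zt.
move=> Q nQ; have uQ : \forall x \near P z, Gam x -> Q (u x) := cu _ Gz Q nQ.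
have uPQ := continuous_near _ (closest_point_continuous z zt) uQ.
have : \forall w \near z, tube Gam eps w -> Q (u (P w)).
  by apply: filterS uPQ => w uw tw; exact: uw (closest_point_in _ tw).
exact.
Qed.

Lemma viscosity_solution_extension (nu : V -> V) mu (Tgt : set V) (f r : V -> V -> R)
    (g u : V -> R) :
  (forall z, tube Gam eps z -> forall i, dot (nu z) (t z i) = 0) ->
  viscosity_solution Gam Tgt (C1_surface Gam) (surface_grad Gam)
    (hamiltonian (unit_tangents Gam) r (fun x a => f x a *: a)) g u ->
  viscosity_solution (tube Gam eps) (tube Gam eps `&` P @^-1` Tgt)
    (Ck_on 1 (tube Gam eps)) grad
    (hamiltonian (fun z => unit_tangents Gam (P z)) (fun z a => r (P z) a)
      (fun z a => f (P z) a *: (a *m tensorB (n := m.+1) (t z) (nu z) (sigma z) mu)))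
    (g \o P) (u \o P).
Proof.
move=> nu_t [cu ug usub usup]; split.
- exact: closest_point_comp_continuous.
- by move=> z [_ Tz]; exact: ug.
- move=> psi z Cpsi [zt zK] zmax; have dpsi := Cpsi.1 z zt.
  rewrite -(hamiltonian_offset_fun z psi nu mu f r zt dpsi (nu_t z zt)).
  apply: usub; last exact: local_max_offset.
    by apply: C1_offset_fun => //; exact: normal_coordinate_lt.
  by split=> [|Tz]; [exact: closest_point_in | apply: zK].
- move=> psi z Cpsi [zt zK] zmin; have dpsi := Cpsi.1 z zt.
  rewrite -(hamiltonian_offset_fun z psi nu mu f r zt dpsi (nu_t z zt)).
  apply: usup; last exact: local_min_offset.
    by apply: C1_offset_fun => //; exact: normal_coordinate_lt.
  by split=> [|Tz]; [exact: closest_point_in | apply: zK].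
Qed.

End Tube.

Theorem theorem2p4 (R : realType) (n : nat) (hn : n = 2%N \/ n = 3%N)
  (Om : set 'rV[R]_n)
  (Om_bounded : bounded_set Om) (Om_connected : connected Om)
  (Om_open : open Om) (Om_smooth : smooth_boundary Om)
  (eps : R) (eps_gt0 : 0 < eps)
  (eps_reach : (eps%:E < reach (boundary Om))%E)
  (P_diff : forall z, tube (boundary Om) eps z ->
    differentiable (closest_point (boundary Om)) z)
  (t : 'rV[R]_n -> 'I_n.-1 -> 'rV[R]_n) (nu : 'rV[R]_n -> 'rV[R]_n)
  (kappa sigma : 'rV[R]_n -> 'I_n.-1 -> R)
  (frame : forall z, tube (boundary Om) eps z ->
    principal_frame Om eps z (t z) (nu z) (kappa z) (sigma z))
  (mu : R)
  (Tgt : set 'rV[R]_n) (Tgt_closed : closed Tgt)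
  (Tgt_sub : Tgt `<=` boundary Om)
  (f r : 'rV[R]_n -> 'rV[R]_n -> R) (g : 'rV[R]_n -> R) :
  let Gam := boundary Om in
  let P := closest_point Gam in
  let A := \bigcup_(x in Gam) unit_tangents Gam x in
  forall
  (f_lip : forall a, A a -> [lipschitz f x a | x in Gam])
  (r_lip : forall a, A a -> [lipschitz r x a | x in Gam])
  (g_lsc : @lower_semicontinuous (subspace Tgt) R (EFin \o g))
  (g_min : (ereal_inf [set (g x)%:E | x in Tgt] < +oo)%E)
  (R1 R2 F1 F2 : R) (R1_gt0 : 0 < R1) (F1_gt0 : 0 < F1)
  (r_bnd : forall x a, Gam x -> A a -> R1 <= r x a <= R2)
  (f_bnd : forall x a, Gam x -> A a -> F1 <= f x a <= F2)
  (u : 'rV[R]_n -> R),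
  viscosity_solution Gam Tgt (C1_surface Gam) (surface_grad Gam)
    (hamiltonian (unit_tangents Gam) r (fun x a => f x a *: a))
    g u ->
  viscosity_solution (tube Gam eps) (tube Gam eps `&` P @^-1` Tgt)
    (Ck_on 1 (tube Gam eps)) grad
    (hamiltonian (fun z => unit_tangents Gam (P z)) (fun z a => r (P z) a)
      (fun z a =>
        f (P z) a *: (a *m tensorB (t z) (nu z) (sigma z) mu)))
    (g \o P) (u \o P).
Proof.
(* [hn] excludes dimension 0; in the form [m.+1] the index type ['I_n.-1] of the frame becomes
   ['I_m]. *)
case: n => [|m] in hn Om Om_bounded Om_connected Om_open Om_smooth eps_reach P_diff
  t nu kappa sigma frame Tgt Tgt_closed Tgt_sub f r g *; first by case: hn.
move=> Gam P A _ _ _ _ R1 R2 F1 F2 _ _ _ _ u.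
apply: viscosity_solution_extension => //.
- by move=> z /frame[].
- by move=> z /frame[_ _ _ _ sz] i; have [] := sz i.
- by move=> z /frame[].
(* Principal directions are tangent to the parallel surface through [z], and [nu z] is normal to
   that surface. *)
- by move=> z /frame[_ pd [_ nuT] _ _] i; apply: nuT; have [] := pd i.
Qed.
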